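(* Let $c>0$, $m\in\mathbb{N}$, $j\in\mathbb{N}_0$ with $j+1\ge m$, $b_0=1$, $b_1,\ldots,b_j\in[1,+\infty)$, and let $\sigma$ be a permutation of $\{1,\ldots,j\}$. For $n\in\mathbb{N}$ let $D=\frac{\mathrm{d}}{\mathrm{d}x}$, $$B_s:=\frac{D}{nm}+\frac{b_s-1}{x},\quad 0\le s<m,\qquad B_s:=\frac{xD}{nm}+b_s-1,\quad m\le s\le j,$$ and $$H:=B_{\sigma(j)}\cdots B_{\sigma(1)}B_0 .$$ Let $S(x)=-x^m/c$. Then, as $n\to\infty$, the push-forward measures converge weakly: $$[\![e^{-cnH}x^{nm}]\!]_{nm}\circ S^{-1}\longrightarrow\mu,$$ where $\mu$ is a probability measure on $(-\infty,0]$ whose Cauchy transform $G^{\varnothing,\mathbf b}(t)=\int\frac{\mu(\mathrm{d}z)}{t-z}$ is such that the inverse of $t\mapsto tG^{\varnothing,\mathbf b}(t)$, $t>0$, is $$(0,1)\ni\alpha\mapsto\frac{\alpha}{1-\alpha}\prod_{s=1}^j(b_s-1+\alpha).$$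
   Context: The operators act on polynomials in $x$; $\frac{b_s-1}{x}$ and $x$ denote multiplication operators, and $B_0=\frac{D}{nm}$ since $b_0=1$. The operator $H$ depends on $n$ and lowers the degree of a monomial $x^\ell$, $\ell\geq m$, by $m$. By definition $e^{-cnH}x^{nm}=\sum_{k\ge0}\frac{(-cn)^k}{k!}H^kx^{nm}$, which is a finite sum because $H^kx^{nm}=0$ for $k>n$, so it is a polynomial of degree $nm$. For a polynomial $P$ of degree $N$, $[\![P]\!]_N=\frac1N\sum_{z\in\mathbb{C}:P(z)=0}\delta_z$ (zeros counted with multiplicity), and $[\![P]\!]_N\circ S^{-1}$ is its push-forward under $S$. *)

(* Defs.v *)
From HB Require Import structures.
From mathcomp Require Import all_boot all_order all_algebra.
From mathcomp Require Import all_fingroup complex.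
From mathcomp Require Import all_classical all_reals all_analysis.

Set Implicit Arguments.
Unset Strict Implicit.
Unset Printing Implicit Defensive.

Import Order.TTheory GRing.Theory Num.Theory.
Import numFieldNormedType.Exports.

Local Open Scope classical_set_scope.
Local Open Scope ring_scope.
Local Open Scope complex_scope.

Definition borel (T : ptopologicalType) := g_sigma_algebraType (@open T).

(* The norm topology on [R[i]] is the one the library puts on the regular
   module [R[i]^o]. *)
Definition borelC (R : realType) := borel (R[i]^o).

Section weak_convergence.
Context {R : realType} {T : ptopologicalType}.
Local Open Scope ereal_scope.

Definition weak_cvg (mu_ : nat -> set (borel T) -> \bar R)
    (mu : set (borel T) -> \bar R) : Prop :=
  forall f : T -> R, continuous f ->
    (exists M : R, forall x, (`|f x| <= M)%R) ->
    (\int[mu_ n]_(x in [set: borel T]) (f x)%:E) @[n --> \oo] -->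
      \int[mu]_(x in [set: borel T]) (f x)%:E.

End weak_convergence.

Section root_measure.
Context {R : realType}.

(* The zeros of [P], listed with multiplicity. *)
Definition zeros (P : {poly R[i]}) : seq R[i] :=
  sval (closed_field_poly_normal P).

Lemma zerosP (P : {poly R[i]}) :
  P = lead_coef P *: \prod_(z <- zeros P) ('X - z%:P).
Proof. exact: svalP (closed_field_poly_normal P). Qed.

Lemma invn_ge0 (N : nat) : 0 <= (N%:R : R)^-1.
Proof. by rewrite invr_ge0. Qed.

Definition root_measure (N : nat) (P : {poly R[i]}) :
    {measure set (borelC R) -> \bar R} :=
  mscale (NngNum (invn_ge0 N))
    (msum (fun k => dirac ((zeros P)`_k : borelC R) : {measure set _ -> \bar R})
      (size (zeros P))).

End root_measure.

Section operators.
Context {R : realType}.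
Variables (n m : nat) (b : nat -> R).

(* [p %/ 'X] discards the constant term of [p].  This is harmless in [H]: on
   ['X^(k * m)] the first operator [B 0] is a multiple of the derivative, so
   constants are sent to [0], and for [0 < k] only [m] of the factors lower the
   degree, so each of them meets a monomial of positive degree. *)
Definition B (s : nat) (p : {poly R}) : {poly R} :=
  if (s < m)%N then (n * m)%:R^-1 *: p^`() + (b s - 1) *: (p %/ 'X)
  else (n * m)%:R^-1 *: ('X * p^`()) + (b s - 1) *: p.

(* A permutation [sigma] of {1, ..., j} is encoded as one of ['I_j], shifted by
   one; [B 0] is applied first and [B (sigma j)] last. *)
Definition H (j : nat) (sigma : {perm 'I_j}) (p : {poly R}) : {poly R} :=
  foldl (fun q i => B (sigma i).+1 q) (B 0 p) (enum 'I_j).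

(* The exponential series of [e^{-cnH}] applied to [x^{nm}]; its terms of index
   [k > n] vanish, see [iter_H_eq0]. *)
Definition expH (c : R) (j : nat) (sigma : {perm 'I_j}) : {poly R} :=
  \sum_(k < n.+1)
    ((- (c * n%:R)) ^+ k / k`!%:R) *: iter k (H sigma) 'X^(n * m).

Lemma size_B s p : (size (B s p) <= size p - (s < m))%N.
Proof.
have sZ a (q : {poly R}) : (size (a *: q) <= size q)%N by exact: size_scale_leq.
have sd : (size p^`() <= (size p).-1)%N.
  by have [->|p0] := eqVneq p 0; rewrite ?deriv0 ?size_poly0// -ltnS
    prednK ?size_poly_gt0// lt_size_deriv.
rewrite /B; case: ifP => _; apply: (leq_trans (size_polyD _ _));
  rewrite geq_max ?subn1 ?subn0.
  by rewrite !(leq_trans (sZ _ _))// size_divp ?polyX_eq0// size_polyX subn1.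
rewrite !(leq_trans (sZ _ _))//.
have [->|p0] := eqVneq p 0; first by rewrite deriv0 mulr0.
apply: (leq_trans (size_polyMleq _ _)); rewrite size_polyX /=.
by rewrite -(@prednK (size p)) ?size_poly_gt0// ltnS.
Qed.

Lemma B0r s : B s 0 = 0.
Proof. by rewrite /B; case: ifP; rewrite deriv0 ?div0p ?mulr0 !scaler0 addr0. Qed.

Lemma size_H j (sigma : {perm 'I_j}) p : (0 < m <= j.+1)%N ->
  (size (H sigma p) <= size p - m)%N.
Proof.
move=> /andP[m0 mj].
have fl s q : (size (foldl (fun q (i : 'I_j) => B (sigma i).+1 q) q s) <=
    size q - \sum_(i <- s) ((sigma i).+1 < m))%N.
  elim: s q => [|i s IH] q /=; first by rewrite big_nil subn0.
  rewrite (leq_trans (IH _))// big_cons subnDA leq_sub2r//; exact: size_B.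
rewrite (leq_trans (fl _ _))// big_enum /=.
rewrite -(reindex_inj (@perm_inj _ sigma) (P := xpredT)
  (F := fun i : 'I_j => nat_of_bool (i.+1 < m)%N))/=.
have -> : (\sum_(i < j) (i.+1 < m) = m.-1)%N.
  rewrite -(big_mkord xpredT (fun i => nat_of_bool (i.+1 < m)%N)).
  rewrite (@big_cat_nat _ _ _ m.-1)//=; last by rewrite -ltnS prednK.
  rewrite big_nat (eq_bigr (fun=> 1%N)); last first.
    by move=> i /andP[_ im]; rewrite -[X in (_ < X)%N](prednK m0) ltnS im.
  rewrite -big_nat sum_nat_const_nat subn0 muln1 big_nat big1 ?addn0//.
  by move=> i /andP[im _]; rewrite -[X in (_ < X)%N](prednK m0) ltnS ltnNge im.
apply: (leq_trans (leq_sub2r _ (size_B _ _))).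
by rewrite m0 -subnDA add1n prednK.
Qed.

Lemma iter_H_eq0 j (sigma : {perm 'I_j}) (k : nat) :
  (0 < m <= j.+1)%N -> b 0 = 1 -> (n < k)%N ->
  iter k (H sigma) 'X^(n * m) = 0.
Proof.
move=> mj b0 nk; have [m0 _] := andP mj.
have H0 (p : {poly R}) : B 0 p = 0 -> H sigma p = 0.
  by rewrite /H => ->; elim: (enum _) => //= i s IH; rewrite B0r.
have sI i : (size (iter i (H sigma) 'X^(n * m)) <= (n * m).+1 - i * m)%N.
  elim: i => [|i IH]; first by rewrite mul0n subn0 size_polyXn.
  by rewrite iterS mulSn addnC subnDA (leq_trans (size_H _ _ mj))// leq_sub2r.
rewrite -(subnK nk) iterD; have -> : iter n.+1 (H sigma) 'X^(n * m) = 0.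
  rewrite iterS; apply: H0; move: (sI n); rewrite subSnn.
  move=> /size1_polyC ->.
  by rewrite /B m0 b0 subrr scale0r derivC scaler0 addr0.
by elim: (k - n.+1)%N => //= i ->; apply: H0; rewrite B0r.
Qed.

End operators.

Section transforms.
Context {R : realType}.

Definition cauchy_transform (mu : probability (measurableTypeR R) R) (t : R) : R :=
  \int[mu]_z (t - z)^-1.

(* [f] maps [X] bijectively onto [Y], with inverse [g]. *)
Definition inverse_between (X Y : set R) (f g : R -> R) : Prop :=
  [/\ set_fun X Y f, set_fun Y X g, {in X, cancel f g} & {in Y, cancel g f}].

End transforms.

(* Main.v *)
Require Import Defs.
From mathcomp Require Import all_boot all_order all_algebra.
From mathcomp Require Import all_fingroup complex.
From mathcomp Require Import all_classical all_reals all_analysis.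
From mathcomp Require Import measurable_realfun.
From mathcomp Require Import ring lra zify.

Set Implicit Arguments.
Unset Strict Implicit.
Unset Printing Implicit Defensive.

Import Order.TTheory GRing.Theory Num.Theory.
Import numFieldNormedType.Exports.

Local Open Scope classical_set_scope.
Local Open Scope ring_scope.
Local Open Scope complex_scope.

(** Write [e^{-cnH} x^{nm}] in the variable [w], where [x^m = - c w]; this is the
    change of variable made by [S].  Applied to a power of [x^m], each factor of
    [H] multiplies by a number close to [k / n + b_s - 1], so the polynomial becomes,
    up to a constant, the sum over [k <= n] of
      ['C(n, k) * \prod_s \prod_(i < k) (1 + a_s - i / n) * w^(n - k)],
    with [a_s] between [b_s - 1 - 1 / n] and [b_s - 1] ([iter_H_Xn]).

    The factors indexed by [s] are Laguerre multiplier sequences, which preserve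
    the polynomials whose zeros are real and nonpositive.  The proof is by
    a sign of imaginary parts: adding one zero amounts to a first order
    differential operator, whose action on the logarithmic derivative shows that no
    zero can leave the real line ([rstep_root_real], [rpoly_multiplier]).  Hence the
    pushed forward root measure is the empirical measure of [n] points [- r_i] of the
    half-line ([expH_factor], [zeros_prod_XnsubC]).

    The transform [t G(t)] of this empirical measure is the mean of [1 - k / n] when
    [k] is drawn with weight proportional to the [k]-th term of the sum at [w = t].
    The ratio of consecutive terms crosses [1] where [1 - k / n] is near the
    solution [alpha] of
      [t = alpha / (1 - alpha) * \prod_s (b_s - 1 + alpha)],
    and a variance bound shows that the mean converges to [alpha]
    ([mean_resolvent_approx], [cvg_resolvent]).  This is the announced inverse
    function.

    It remains to pass from convergence of transforms at all [t > 0] to weak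
    convergence ([weak_limit_of_resolvents]).  In the bounded variable
    [v = (1 + r)^-1] the transforms determine the limits of all moments
    ([cvg_avg_powers]); a limit of the quantile functions realizes these moments
    ([limit_quantile]); polynomials are dense among the continuous functions on
    [[0, 1]] ([weierstrass01]); and no mass is lost at [v = 0], that is at infinity,
    because [alpha] takes values arbitrarily close to [1]. *)

(** * Polynomials with nonpositive real zeros and multiplier sequences *)

(** A polynomial with constant term [1] is recorded by the opposites of the
    inverses of its zeros; [r = 0] stands for a zero at infinity, so that lists of
    one length serve for all degrees up to that length. *)
Definition rpoly (F : fieldType) (rs : seq F) : {poly F} :=
  \prod_(r <- rs) (1 + r *: 'X).

Lemma horner_rpoly (F : fieldType) (rs : seq F) (x : F) :
  (rpoly rs).[x] = \prod_(r <- rs) (1 + r * x).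
Proof.
by rewrite horner_prod; apply: eq_bigr => r _; rewrite !hornerE.
Qed.

Lemma rpoly_coef0 (F : fieldType) (rs : seq F) : (rpoly rs)`_0 = 1.
Proof.
by rewrite -horner_coef0 horner_rpoly big1 // => r _; rewrite mulr0 addr0.
Qed.

Lemma size_rpoly (F : fieldType) (rs : seq F) :
  (size (rpoly rs) <= (size rs).+1)%N.
Proof.
elim: rs => [|r rs IH]; first by rewrite /rpoly big_nil size_poly1.
rewrite /rpoly big_cons (leq_trans (size_polyMleq _ _))//.
have : (size (1 + r *: 'X : {poly F})%R <= 2)%N.
  apply: (leq_trans (size_polyD _ _)); rewrite geq_max size_poly1 /=.
  by rewrite (leq_trans (size_scale_leq _ _))// size_polyX.
move: IH; rewrite /rpoly /=; move: (size _) (size _) => a b; lia.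
Qed.

(** The logarithmic derivative in terms of the numbers [(1 + r x)^-1]: their
    imaginary parts have a known sign when [x] is not real, and at [x = t^-1] they
    are the values [t / (t + r)] of the resolvent. *)
Lemma horner_deriv_rpoly (F : fieldType) (rs : seq F) (x : F) :
  {in rs, forall r, 1 + r * x != 0} ->
  x * (rpoly rs)^`().[x] =
    (rpoly rs).[x] * ((size rs)%:R - \sum_(r <- rs) (1 + r * x)^-1).
Proof.
elim: rs => [|r rs IH] h.
  by rewrite /rpoly !big_nil derivC hornerE subr0 !mulr0.
have r0 : 1 + r * x != 0 by apply: h; rewrite mem_head.
have {}IH := IH (fun s hs => h s (mem_behead (s := r :: rs) hs)).
have -> : rpoly (r :: rs) = (1 + r *: 'X) * rpoly rs by rewrite /rpoly big_cons.
rewrite big_cons derivM derivD derivZ derivX derivC add0r hornerD !hornerM.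
rewrite mulrDr [X in _ + X]mulrCA IH !hornerE /= -natr1.
by field.
Qed.

(** A zero [a] is real, and negative since [P] does not vanish on the nonnegative
    half-line; it gives the factor with [r = - a^-1].  If the degree is less than
    [k], factors with [r = 0] are added. *)
Lemma rpoly_of_real_roots (R : rcfType) (k : nat) (P : {poly R}) :
  (size P <= k.+1)%N -> P`_0 = 1 -> (forall x, 0 <= x -> P.[x] != 0) ->
  (forall z, root (map_poly (real_complex R) P) z -> complex.Im z = 0) ->
  exists rs, [/\ size rs = k, {in rs, forall r, 0 <= r} & P = rpoly rs].
Proof.
move=> sP P0 Pnz Preal.
pose zs := sval (closed_field_poly_normal (map_poly (real_complex R) P)).
have PE : map_poly (real_complex R) P = _ *: \prod_(z <- zs) ('X - z%:P) :=
  svalP (closed_field_poly_normal (map_poly (real_complex R) P)).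
have Pn0 : P != 0 by apply: contraNneq (Pnz 0 (lexx _)) => ->; rewrite horner0.
have l0 : lead_coef (map_poly (real_complex R) P) != 0.
  by rewrite lead_coef_eq0 map_poly_eq0.
have [l zsE] : exists l, zs = map (real_complex R) l.
  exists (map (@complex.Re R) zs); rewrite -map_comp -[LHS]map_id; apply/eq_in_map => z zzs /=.
  have /Preal : root (map_poly (real_complex R) P) z.
    by rewrite PE rootZ// root_prod_XsubC.
  by case: z {zzs} => a b /= ->.
have PEr : P = lead_coef P *: \prod_(a <- l) ('X - a%:P).
  apply: (@map_poly_inj _ _ (real_complex R)).
  rewrite PE lead_coef_map map_polyZ zsE big_map rmorph_prod /=; congr (_ *: _).
  by apply: eq_bigr => a _; rewrite rmorphB /= map_polyX map_polyC.
have lead0 : lead_coef P != 0 by rewrite lead_coef_eq0.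
have lneg a : a \in l -> a < 0.
  move=> al; rewrite ltNge; apply/negP => /Pnz/negP; apply.
  by rewrite -/(root P a) PEr rootZ// root_prod_XsubC.
have sl : (size l <= k)%N.
  by move: sP; rewrite PEr size_scale// size_prod_XsubC.
exists (map (fun a => - a^-1) l ++ nseq (k - size l) 0); split.
- by rewrite size_cat size_map size_nseq subnKC.
- move=> r; rewrite mem_cat => /orP[/mapP[a al ->]|].
    by rewrite oppr_ge0 invr_le0 ltW// lneg.
  by rewrite mem_nseq => /andP[_ /eqP->].
have lE : \prod_(a <- l) ('X - a%:P) =
    (\prod_(a <- l) (- a)) *: rpoly (map (fun a => - a^-1) l).
  rewrite /rpoly big_map -scaler_prod.
  apply: eq_big_seq => a /lneg a0.
  rewrite scalerDr scalerA mulrNN divff ?lt_eqF// scale1r.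
  by rewrite alg_polyC polyCN addrC.
have -> : rpoly ([seq - a^-1 | a <- l] ++ nseq (k - size l) 0) =
    rpoly [seq - a^-1 | a <- l].
  rewrite /rpoly big_cat /= [X in _ * X]big1_seq ?mulr1// => a /=.
  by rewrite mem_nseq => /andP[_ /eqP->]; rewrite scale0r addr0.
have PE1 : P = (lead_coef P * \prod_(a <- l) - a) *: rpoly [seq - a^-1 | a <- l].
  by rewrite -scalerA -lE.
move: P0; rewrite {1}PE1 coefZ rpoly_coef0 mulr1 => c1.
by rewrite [LHS]PE1 c1 scale1r.
Qed.

Lemma horner_rpoly_neq0 (R : rcfType) (rs : seq R) (z : R[i]) :
  {in rs, forall r, 0 <= r} -> complex.Im z != 0 ->
  {in rs, forall r, 1 + r%:C * z != 0}.
Proof.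
move=> rs0 z0 r /rs0 r0; apply/eqP; case: z z0 => a b /= b0; simpc.
move=> -[h1 /eqP]; rewrite mulf_eq0 (negbTE b0) orbF => /eqP h2.
by move: h1; rewrite h2 mul0r addr0 => /eqP; rewrite oner_eq0.
Qed.

(** If [T] multiplies the coefficient of ['X^k] by the product of
    [1 + a - nu * i] over [i < k], then [T ((1 + x *: 'X) * p)] is
    [rstep nu a x (T p)]; see [rstep_coef]. *)
Definition rstep (F : fieldType) (nu a x : F) (p : {poly F}) : {poly F} :=
  p + x *: ('X * ((1 + a) *: p - nu *: ('X * p^`()))).

Lemma horner_rstep (F : fieldType) (nu a x : F) (rs : seq F) (y : F) :
  {in rs, forall r, 1 + r * y != 0} ->
  (rstep nu a x (rpoly rs)).[y] = (rpoly rs).[y] *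
    (1 + x * y * (1 + a - nu * (size rs)%:R
                  + nu * \sum_(r <- rs) (1 + r * y)^-1)).
Proof.
move=> h; rewrite /rstep hornerD hornerZ hornerM hornerX hornerD hornerN.
rewrite !hornerZ hornerM hornerX horner_deriv_rpoly//; ring.
Qed.

Lemma rpoly_map (R : rcfType) (rs : seq R) :
  map_poly (real_complex R) (rpoly rs) = rpoly (map (real_complex R) rs).
Proof.
rewrite /rpoly big_map rmorph_prod; apply: eq_bigr => r _ /=.
by rewrite rmorphD rmorph1 /= map_polyZ map_polyX.
Qed.

Lemma rstep_map (R : rcfType) (nu a x : R) (p : {poly R}) :
  map_poly (real_complex R) (rstep nu a x p) =
  rstep nu%:C a%:C x%:C (map_poly (real_complex R) p).
Proof.
rewrite /rstep deriv_map rmorphD /= map_polyZ rmorphM /= map_polyX rmorphB /=.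
by rewrite !map_polyZ rmorphM /= map_polyX rmorphD.
Qed.

Lemma mulr_ImV (R : rcfType) (z : R[i]) : complex.Im z != 0 ->
  complex.Im z * complex.Im z^-1 < 0.
Proof.
case: z => a b /= b0; rewrite ?mulNr mulrN oppr_lt0 mulrA -expr2.
by rewrite divr_gt0// ?ltr_wpDl ?sqr_ge0// exprn_even_gt0.
Qed.

Lemma mulr_ImV1D_le0 (R : rcfType) (z : R[i]) (r : R) : 0 <= r ->
  complex.Im z * complex.Im (1 + r%:C * z)^-1 <= 0.
Proof.
case: z => a b r0; simpc => /=; rewrite -mulNr.
rewrite mulrA mulr_le0_ge0 ?invr_ge0 ?addr_ge0 ?sqr_ge0//.
by rewrite mulNr oppr_le0 mulrCA mulr_ge0// -expr2 sqr_ge0.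
Qed.

Lemma ImD (R : rcfType) (z w : R[i]) :
  complex.Im (z + w) = complex.Im z + complex.Im w.
Proof. by case: z; case: w. Qed.

Lemma ImZ (R : rcfType) (x : R) (z : R[i]) :
  complex.Im (x%:C * z) = x * complex.Im z.
Proof. by case: z => a b; simpc. Qed.

(** After division by the value of [rpoly rs] at [z], a zero [z] satisfies
    [z^-1 + x * w = 0], where [w] is a nonnegative number plus nonnegative multiples
    of the [(1 + r z)^-1].  When [z] is not real, the imaginary part of [z^-1] is
    nonzero of the sign opposite to that of [z], and that of [w] is not of the other
    sign, so the two terms cannot cancel. *)
Lemma rstep_root_real (R : rcfType) (nu a x : R) (rs : seq R) (z : R[i]) :
  0 <= nu -> nu * (size rs)%:R <= 1 + a -> 0 <= x ->
  {in rs, forall r, 0 <= r} ->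
  root (map_poly (real_complex R) (rstep nu a x (rpoly rs))) z ->
  complex.Im z = 0.
Proof.
move=> nu0 na x0 rs0 rz; apply/eqP; apply: contraTT rz => z0.
have nz := horner_rpoly_neq0 rs0 z0.
have nzm : {in map (real_complex R) rs, forall r, 1 + r * z != 0}.
  by move=> _ /mapP[r rrs ->]; exact: nz.
rewrite rstep_map rpoly_map /root horner_rstep// mulf_eq0 negb_or.
apply/andP; split.
  rewrite horner_rpoly big_map prodf_seq_neq0; apply/allP => r rrs /=.
  exact: nz.
rewrite size_map big_map.
set w := (X in x%:C * z * X).
have zn0 : z != 0 by apply: contraNneq z0 => ->.
have Imw : complex.Im z * complex.Im w <= 0.
  have -> : w = (1 + a - nu * (size rs)%:R)%:C +
      nu%:C * \sum_(r <- rs) (1 + r%:C * z)^-1.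
    by rewrite /w rmorphB rmorphD rmorphM rmorph1 rmorph_nat.
  rewrite ImD ImZ /= add0r mulrCA mulr_ge0_le0//.
  elim: rs {rs0 nz nzm na w} => [|r rs IH] in rs0 *; first by rewrite big_nil mulr0.
  rewrite big_cons ImD mulrDr -[X in _ <= X]addr0 lerD//; last first.
    by apply: IH => s srs; apply: rs0; rewrite in_cons srs orbT.
  by rewrite mulr_ImV1D_le0// rs0// mem_head.
apply/eqP => E.
have zV : z^-1 = (- x)%:C * w.
  apply: (mulfI zn0); rewrite divff//; apply/eqP.
  by rewrite -subr_eq0 -E rmorphN /=; apply/eqP; ring.
have := mulr_ImV z0; rewrite zV ImZ mulrCA ltNge => /negP; apply.
by rewrite mulr_le0// oppr_le0.
Qed.

Lemma rstep_coef (F : fieldType) (nu a x : F) (p : {poly F}) (k : nat) :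
  (rstep nu a x p)`_k.+1 = p`_k.+1 + x * (p`_k * (1 + a - nu * k%:R)).
Proof.
rewrite /rstep coefD coefZ coefXM /= coefB !coefZ coefXM coef_deriv.
case: k => [|k] /=; first by rewrite !mulr0 subr0 [1 + a]addrC; ring.
by rewrite -[p`__ *+ _]mulr_natr; ring.
Qed.

Lemma rstep_coef0 (F : fieldType) (nu a x : F) (p : {poly F}) :
  (rstep nu a x p)`_0 = p`_0.
Proof. by rewrite /rstep coefD coefZ coefXM mulr0 addr0. Qed.

Lemma rstep_rpoly (R : rcfType) (nu a x : R) (rs : seq R) :
  0 <= nu -> nu * (size rs)%:R <= 1 + a -> 0 <= x ->
  {in rs, forall r, 0 <= r} ->
  exists rs', [/\ size rs' = (size rs).+1, {in rs', forall r, 0 <= r} &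
    rstep nu a x (rpoly rs) = rpoly rs'].
Proof.
move=> nu0 na x0 rs0; apply: rpoly_of_real_roots.
- apply/leq_sizeP => -[//|k] /=; rewrite ltnS => sk; rewrite rstep_coef.
  have c0 l : (size rs < l)%N -> (rpoly rs)`_l = 0.
    by move=> h; rewrite nth_default// (leq_trans (size_rpoly _)).
  by rewrite !c0// ?mul0r ?mulr0 ?addr0// ltnS ltnW.
- by rewrite rstep_coef0 rpoly_coef0.
- move=> y y0.
  have pos r : r \in rs -> 0 < 1 + r * y.
    by move=> /rs0 r0; rewrite ltr_wpDr// mulr_ge0.
  rewrite horner_rstep; last by move=> r /pos /lt0r_neq0.
  rewrite mulf_neq0//.
    rewrite horner_rpoly prodf_seq_neq0; apply/allP => r /pos /lt0r_neq0.
    by move=> ->; rewrite implybT.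
  rewrite lt0r_neq0// ltr_wpDr// !mulr_ge0// addr_ge0// ?subr_ge0//.
  by rewrite mulr_ge0// big_seq sumr_ge0// => r /pos /ltW; rewrite invr_ge0.
- by move=> z; exact: rstep_root_real.
Qed.

(** Induction on the number of factors.  When a factor is added to [k < n] others,
    the side condition of [rstep_rpoly] is [k / n <= 1 + a]; this is where the
    lower bound [- 1 / n] on [a] comes from. *)
Lemma rpoly_multiplier_sub (R : rcfType) (n : nat) (a : R) (rs : seq R) :
  (size rs <= n)%N -> - n%:R^-1 <= a -> {in rs, forall r, 0 <= r} ->
  exists rs', [/\ size rs' = size rs, {in rs', forall r, 0 <= r} &
    forall k, (rpoly rs')`_k =
      (rpoly rs)`_k * \prod_(i < k) (1 + a - n%:R^-1 * i%:R)].
Proof.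
move=> + an; elim: rs => [|x rs IH] srs rs0.
  exists [::]; split=> // k; rewrite /rpoly big_nil coef1.
  by case: k => [|k]; rewrite ?big_ord0 ?mulr1 ?mul0r.
have [||rs1 [srs1 rs10 rs1E]] := IH; first exact: ltnW.
  by move=> r rrs; apply: rs0; rewrite in_cons rrs orbT.
have n0 : (0 < n)%N by exact: leq_trans srs.
have [|||| rs' [srs' rs'0 E]] := @rstep_rpoly _ n%:R^-1 a x rs1.
- by rewrite invr_ge0.
- rewrite srs1 -lerBlDl (le_trans _ an)// -subr_ge0.
  have -> : - n%:R^-1 - (n%:R^-1 * (size rs)%:R - 1) =
      n%:R^-1 * (n%:R - (size rs).+1%:R) :> R.
    by rewrite mulrBr mulVf ?pnatr_eq0 -?lt0n// -natr1; ring.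
  by rewrite mulr_ge0 ?invr_ge0// subr_ge0 ler_nat.
- by apply: rs0; rewrite mem_head.
- exact: rs10.
exists rs'; split; [by rewrite srs' srs1|exact: rs'0|move=> k].
rewrite -E; have -> : rpoly (x :: rs) = rpoly rs + x *: ('X * rpoly rs).
  by rewrite /rpoly big_cons mulrDl mul1r -scalerAl.
case: k => [|k].
  by rewrite rstep_coef0 rs1E coefD coefZ coefXM mulr0 addr0.
rewrite rstep_coef !rs1E coefD coefZ coefXM /= big_ord_recr /=; ring.
Qed.

(** The Laguerre multiplier sequences applied one after the other to
    [(1 + 'X) ^+ n]; up to a change of variable this is a finite free
    multiplicative convolution of Laguerre polynomials. *)
Lemma rpoly_multiplier (R : rcfType) (n : nat) (l : seq R) :
  {in l, forall a, - n%:R^-1 <= a} ->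
  exists rs, [/\ size rs = n, {in rs, forall r : R, 0 <= r} &
    forall k, (rpoly rs)`_k =
      'C(n, k)%:R * \prod_(a <- l) \prod_(i < k) (1 + a - n%:R^-1 * i%:R)].
Proof.
elim: l => [|a l IH] la.
  exists (nseq n 1); split; first exact: size_nseq.
    by move=> r; rewrite mem_nseq => /andP[_ /eqP ->].
  move=> k; rewrite big_nil mulr1 /rpoly big_nseq scale1r.
  rewrite -Monoid.iteropE -/(_ ^+ n) addrC exprD1n.
  under eq_bigr => i _ do rewrite -['X^i *+ _]scaler_nat.
  rewrite -(poly_def n.+1 (fun i => 'C(n, i)%:R)) coef_poly.
  by case: ltnP => // ?; rewrite bin_small.
have [|rs [srs rs0 rsE]] := IH.
  by move=> b bl; apply: la; rewrite in_cons bl orbT.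
have [|||rs' [srs' rs'0 E]] := @rpoly_multiplier_sub _ n a rs.
- by rewrite srs.
- by apply: la; rewrite mem_head.
- exact: rs0.
exists rs'; split=> //; first by rewrite srs'.
by move=> k; rewrite E rsE big_cons -mulrA [X in _ * X]mulrC.
Qed.

(** * Concentration of the coefficients *)

Lemma ler_dist_prod (R : realFieldType) (I : Type) (l : seq I) (f g m : I -> R)
    (d : R) :
  (forall i, [/\ `|f i| <= m i, `|g i| <= m i, 1 <= m i & `|f i - g i| <= d]) ->
  `|\prod_(i <- l) f i - \prod_(i <- l) g i| <=
    (size l)%:R * d * \prod_(i <- l) m i.
Proof.
move=> h; elim: l => [|i l IH]; first by rewrite !big_nil subrr normr0 !mul0r.
have [fm gm m1 fg] := h i; rewrite !big_cons.
have d0 : 0 <= d by exact: le_trans fg.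
have fl : `|\prod_(i <- l) f i| <= \prod_(i <- l) m i.
  rewrite normr_prod; apply: ler_prod => k _; have [? _ _ _] := h k.
  by rewrite normr_ge0.
have m0 : 0 <= \prod_(i <- l) m i by exact: le_trans fl.
have -> : f i * \prod_(j <- l) f j - g i * \prod_(j <- l) g j =
  (f i - g i) * \prod_(j <- l) f j +
  g i * (\prod_(j <- l) f j - \prod_(j <- l) g j) by ring.
rewrite (le_trans (ler_normD _ _))// !normrM -natr1.
have -> : ((size l)%:R + 1) * d * (m i * \prod_(j <- l) m j) =
  (m i * d) * \prod_(j <- l) m j + m i * ((size l)%:R * d * \prod_(j <- l) m j).
  by ring.
apply: lerD; apply: ler_pM => //.
by rewrite (le_trans fg)// ler_peMl.
Qed.

(** At [x > 0] the terms [W k] of the polynomial are nonnegative weights, and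
    the mean of [u k = 1 - k / n] under them is the mean of the [(1 + r x)^-1].
    The ratio of successive weights is explicit, so a summation by parts shows that
    [(1 - u - x * thn u) * (u - al)] has mean of order [1 / n].  As [1 - u - x * th u]
    decreases through [0] at [u = al], this bounds the variance about [al]. *)
Section concentration.
Variables (R : realFieldType) (n j : nat) (a be : 'I_j -> R) (x al : R).
Hypotheses (n0 : (0 < n)%N) (be0 : forall s, 0 <= be s)
  (a_be : forall s, be s - n%:R^-1 <= a s <= be s).
Hypotheses (x0 : 0 <= x) (al01 : 0 <= al <= 1)
  (alE : 1 - al = x * (al * \prod_(s < j) (al + be s))).

Let M := \prod_(s < j) (1 + be s).
Let u k : R := 1 - n%:R^-1 * k%:R.
Let th v := v * \prod_(s < j) (v + be s).
Let thn v := v * \prod_(s < j) (v + a s).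
Let W k := 'C(n, k)%:R * (\prod_(s < j) \prod_(i < k) (1 + a s - n%:R^-1 * i%:R))
  * x ^+ k.

Let nn0 : n%:R != 0 :> R. Proof. by rewrite pnatr_eq0 -lt0n. Qed.

Let u01 k : (k <= n)%N -> 0 <= u k <= 1.
Proof.
move=> kn; rewrite subr_ge0 mulrC ler_pdivrMr ?ltr0n// mul1r ler_nat kn /=.
by rewrite lerBlDr lerDl mulr_ge0 ?invr_ge0.
Qed.

Let W_ge0 k : (k <= n)%N -> 0 <= W k.
Proof.
move=> kn; rewrite !mulr_ge0 ?exprn_ge0// prodr_ge0// => s _.
rewrite prodr_ge0// => i _; have /andP[+ _] := a_be s; have := be0 s.
have : n%:R^-1 * i.+1%:R <= 1 :> R.
  by rewrite mulrC ler_pdivrMr ?ltr0n// mul1r ler_nat (leq_trans (ltn_ord i)).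
by rewrite -natr1 mulrDr mulr1; lra.
Qed.

Let W_rec k : n%:R^-1 * k.+1%:R * W k.+1 = x * thn (u k) * W k.
Proof.
have [kn|kn] := ltnP n k.
  by rewrite /W !bin_small ?(ltnW kn)// ?mul0r ?mulr0// ltnS ltnW.
have C : k.+1%:R * 'C(n, k.+1)%:R = (n%:R - k%:R) * 'C(n, k)%:R :> R.
  by rewrite -natrB// -!natrM mul_bin_left.
rewrite /W /thn /u exprS.
have -> : \prod_(s < j) \prod_(i < k.+1) (1 + a s - n%:R^-1 * i%:R) =
    (\prod_(s < j) \prod_(i < k) (1 + a s - n%:R^-1 * i%:R)) *
    \prod_(s < j) (1 - n%:R^-1 * k%:R + a s).
  rewrite -big_split; apply: eq_bigr => s _ /=; rewrite big_ord_recr /=; ring.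
have -> : 1 - n%:R^-1 * k%:R = n%:R^-1 * (n%:R - k%:R) :> R by field.
set p := \prod_(s < j) \prod_(i < k) _; set q := \prod_(s < j) _.
transitivity (n%:R^-1 * (k.+1%:R * 'C(n, k.+1)%:R) * p * q * x * x ^+ k).
  by ring.
by rewrite C; ring.
Qed.

Let W_sum_by_parts (g : nat -> R) :
  \sum_(k < n.+1) W k * ((1 - u k) * g k - x * thn (u k) * g k.+1) = 0.
Proof.
under eq_bigr do rewrite mulrBr; rewrite sumrB; apply/eqP; rewrite subr_eq0.
rewrite big_ord_recl big_ord_recr /= {1 3}/u mulr0 subr0 subrr mul0r mulr0 add0r.
have -> : thn (u n) = 0 by rewrite /thn /u mulVf// subrr mul0r.
rewrite mulr0 mul0r mulr0 addr0; apply/eqP; apply: eq_bigr => i _.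
rewrite /bump /= add1n; transitivity (n%:R^-1 * i.+1%:R * W i.+1 * g i.+1).
  by rewrite /u; ring.
by rewrite W_rec; ring.
Qed.

Let thn_bound v : 0 <= v <= 1 -> thn v <= M.
Proof.
move=> /andP[v0 v1]; rewrite (le_trans (ler_norm _))// normrM.
rewrite (ger0_norm v0) -[M]mul1r ler_pM// normr_prod.
apply: ler_prod => s _; rewrite normr_ge0 /= ler_norml.
have := be0 s; have /andP[] := a_be s.
have : n%:R^-1 <= 1 :> R by rewrite invf_le1 ?ltr0n// ler1n.
by move=> ? ? ? ?; apply/andP; split; lra.
Qed.

Let th_approx v : 0 <= v <= 1 -> `|th v - thn v| <= j%:R * n%:R^-1 * M.
Proof.
move=> /andP[v0 v1]; rewrite -mulrBr normrM ger0_norm//.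
rewrite -[leRHS]mul1r ler_pM//.
have := @ler_dist_prod _ _ (index_enum 'I_j) (fun s => v + be s)
  (fun s => v + a s) (fun s => 1 + be s) n%:R^-1.
have -> : size (index_enum 'I_j) = j by rewrite -sum1_size sum1_card card_ord.
apply => s; have := be0 s; have /andP[] := a_be s.
have : n%:R^-1 <= 1 :> R by rewrite invf_le1 ?ltr0n// ler1n.
by move=> ? ? ? ?; split; rewrite ?ler_norml; [apply/andP; split| apply/andP; split
  | |apply/andP; split]; lra.
Qed.

Let th_mono v w : 0 <= v -> v <= w -> th v <= th w.
Proof.
move=> v0 vw; apply: ler_pM => //; first by rewrite prodr_ge0// => s _; rewrite addr_ge0.
by apply: ler_prod => s _; rewrite addr_ge0//= lerD2r.
Qed.

Let th_crossing v : 0 <= v -> (th al - th v) * (v - al) <= 0.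
Proof.
move=> v0; have /andP[al0 _] := al01.
have [h|/ltW h] := leP v al.
  by rewrite mulr_ge0_le0// ?subr_ge0 ?subr_le0// th_mono.
by rewrite mulr_le0_ge0// ?subr_ge0 ?subr_le0// th_mono.
Qed.

Let variance_bound :
  \sum_(k < n.+1) W k * (u k - al) ^+ 2 <=
  x * (j.+1%:R * M) * n%:R^-1 * \sum_(k < n.+1) W k.
Proof.
rewrite mulr_sumr -subr_ge0 -sumrB -[X in X <= _](W_sum_by_parts (fun k => u k - al)).
apply: ler_sum => k _.
have kn : (k <= n)%N by rewrite -ltnS.
have W0 := W_ge0 kn; have /andP[u0 u1] := u01 kn.
rewrite [X in _ <= X - _]mulrC -mulrBr ler_wpM2l//.
have -> : u k.+1 = u k - n%:R^-1 by rewrite /u -natr1; ring.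
have cr := ler_wpM2l x0 (th_crossing u0); rewrite mulr0 in cr.
have ta : (th (u k) - thn (u k)) * (u k - al) <= j%:R * n%:R^-1 * M.
  rewrite (le_trans (ler_norm _))// normrM -[leRHS]mulr1 ler_pM//.
    by rewrite th_approx ?u0.
  have /andP[? ?] := al01.
  by rewrite ler_norml; apply/andP; split; lra.
have {}ta := ler_wpM2l x0 ta.
have tb : x * (thn (u k) * n%:R^-1) <= x * (M * n%:R^-1).
  by rewrite ler_wpM2l// ler_wpM2r ?invr_ge0// thn_bound ?u0.
have -> : 1 - u k = al - u k + x * th al by rewrite /th -alE; ring.
rewrite -subr_ge0 -natr1.
have -> : x * ((j%:R + 1) * M) * n%:R^-1 - (u k - al) ^+ 2 -
    ((al - u k + x * th al) * (u k - al) - x * thn (u k) * (u k - n%:R^-1 - al)) =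
  (x * (j%:R * n%:R^-1 * M) - x * ((th (u k) - thn (u k)) * (u k - al))) +
  (x * (M * n%:R^-1) - x * (thn (u k) * n%:R^-1)) -
  x * ((th al - th (u k)) * (u k - al)) by ring.
by lra.
Qed.

Lemma mean_resolvent_approx (rs : seq R) : size rs = n ->
  {in rs, forall r, 0 <= r} ->
  (forall k, (rpoly rs)`_k =
    'C(n, k)%:R * \prod_(s < j) \prod_(i < k) (1 + a s - n%:R^-1 * i%:R)) ->
  (n%:R^-1 * (\sum_(r <- rs) (1 + r * x)^-1) - al) ^+ 2 <=
  x * (j.+1%:R * M) * n%:R^-1.
Proof.
move=> srs rs0 rsE.
have sp : (size (rpoly rs) <= n.+1)%N by rewrite -srs size_rpoly.
pose P := \sum_(k < n.+1) W k; pose A := \sum_(k < n.+1) W k * u k.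
have PE : (rpoly rs).[x] = P.
  by rewrite (horner_coef_wide _ sp); apply: eq_bigr => k _; rewrite rsE.
have P_gt0 : 0 < P.
  rewrite /P big_ord_recl ltr_pwDl//.
    by rewrite /W bin0 mul1r expr0 mulr1 big1// => s _; rewrite big_ord0.
  by rewrite sumr_ge0// => k _; apply: W_ge0; rewrite lift0.
have dE : x * (rpoly rs)^`().[x] = n%:R * (P - A).
  have sd : (size (rpoly rs)^`() <= n)%N.
    have [->|p0] := eqVneq (rpoly rs) 0; first by rewrite deriv0 size_poly0.
    by rewrite -ltnS (leq_trans (lt_size_deriv p0)).
  rewrite (horner_coef_wide _ sd) /P /A -sumrB mulr_sumr big_ord_recl /=.
  rewrite [X in X + _](_ : _ = 0).
    rewrite add0r mulr_sumr; apply: eq_bigr => k _; rewrite coef_deriv rsE.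
    rewrite /bump add1n -mulr_natr /W /u exprS; set p := \prod_(s < j) _; by field.
  by rewrite /u /= !(mulr0, subr0, mulr1, subrr).
have mE : n%:R^-1 * (\sum_(r <- rs) (1 + r * x)^-1) = A / P.
  have := dE; rewrite horner_deriv_rpoly; last first.
    by move=> r /rs0 r0; rewrite lt0r_neq0// ltr_wpDr// mulr_ge0.
  rewrite PE srs => h; apply: (mulfI nn0); rewrite mulrA mulfV// mul1r.
  apply: (mulfI (lt0r_neq0 P_gt0)).
  have -> : P * (n%:R * (A / P)) = n%:R * A by field; rewrite lt0r_neq0.
  by move: h; set S := \sum_(r <- rs) _ => h; lra.
rewrite mE -(ler_pM2r P_gt0) (le_trans _ variance_bound)//.
set m := A / P.
have AE : A = m * P by rewrite /m mulfVK// lt0r_neq0.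
(* Jensen's inequality: the square lies above its tangent at the mean [m]. *)
have -> : (m - al) ^+ 2 * P = \sum_(k < n.+1)
    W k * (2 * (m - al) * (u k - al) - (m - al) ^+ 2).
  rewrite (eq_bigr (fun k : 'I__ => 2 * (m - al) * (W k * u k) -
     (2 * (m - al) * al + (m - al) ^+ 2) * W k)); last by move=> k _; ring.
  by rewrite sumrB -!mulr_sumr -/A -/P AE; ring.
apply: ler_sum => k _; rewrite ler_wpM2l//; first by apply: W_ge0; rewrite -ltnS.
by rewrite -subr_ge0 (_ : _ - _ = (u k - m) ^+ 2) ?sqr_ge0//; ring.
Qed.

End concentration.

(** * The operators on powers of the variable *)

Section operators.
Variables (R : realType) (n m j : nat) (b : nat -> R) (sigma : {perm 'I_j}).

Lemma B_Xn s l : ((s < m) <= l)%N ->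
  B n m b s 'X^l = (l%:R / (n * m)%:R + (b s - 1)) *: 'X^(l - (s < m)).
Proof.
move=> sl; rewrite /B; case: (s < m)%N sl => /= sl.
  case: l sl => // l _; rewrite subn1 /= derivXn /= [X in X %/ _]exprSr mulpK ?polyX_eq0//.
  by rewrite -[_ *+ l.+1]scaler_nat scalerA scalerDl mulrC.
rewrite subn0 derivXn -['X^_ *+ _]scaler_nat -scalerAr -exprS scalerDl; congr (_ + _).
by case: l {sl} => [|l]; rewrite ?mul0r ?scale0r ?scaler0// scalerA mulrC.
Qed.

Lemma BZ s a (p : {poly R}) : B n m b s (a *: p) = a *: B n m b s p.
Proof.
rewrite /B; case: ifP => _; rewrite derivZ scalerDr.
  by rewrite divpZl !scalerA [_^-1 * _]mulrC [(b s - 1) * _]mulrC.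
by rewrite -scalerAr !scalerA [_^-1 * _]mulrC [(b s - 1) * _]mulrC.
Qed.

Let foldB (p : {poly R}) (l : seq 'I_j) :=
  foldl (fun q i => B n m b (sigma i).+1 q) p l.

Let foldBZ a p l : foldB (a *: p) l = a *: foldB p l.
Proof. by elim: l p => //= i l IH p; rewrite BZ IH. Qed.

Let small (i : 'I_j) := ((sigma i).+1 < m)%N.

(** [d i] counts the degree-lowering factors applied before the [i]-th one. *)
Let foldB_Xn (l : seq 'I_j) : uniq l -> exists d : 'I_j -> nat,
  (forall i, d i <= count small l)%N /\
  forall k, (count small l <= k)%N -> foldB 'X^k l =
    (\prod_(i <- l) ((k - d i)%N%:R / (n * m)%:R + (b (sigma i).+1 - 1))) *:
      'X^(k - count small l).
Proof.
elim: l => [_|x l IH /= /andP[xl ul]].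
  by exists (fun=> 0%N); split=> // k _; rewrite big_nil scale1r subn0.
have [d [dle dE]] := IH ul.
exists (fun i => if i == x then 0%N else (d i + small x)%N); split=> [i|k ck].
  by case: eqP => // _; rewrite addnC leq_add2l.
rewrite B_Xn; last by rewrite (leq_trans _ ck)// leq_addr.
rewrite -/(foldB _ l) foldBZ dE; last by rewrite leq_subRL ?(leq_trans _ ck) ?leq_addr.
rewrite scalerA big_cons eqxx subn0 subnDA; congr (_ * _ *: _).
apply: eq_big_seq => i il; rewrite ifN; last by apply: contraNneq xl => <-.
by rewrite addnC subnDA.
Qed.

Let count_small : (0 < m <= j.+1)%N -> count small (enum 'I_j) = m.-1.
Proof.
move=> /andP[m0 mj]; rewrite -sum1_count big_enum_cond /=.
rewrite -(reindex_inj (@perm_inj _ sigma)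
  (P := fun i : 'I_j => (i.+1 < m)%N) (F := fun=> 1%N)) /=.
rewrite -[RHS](card_ord m.-1) -sum1_card (big_ord_widen j (fun=> 1%N)); last first.
  by rewrite -ltnS prednK.
by apply: eq_bigl => i; rewrite -[X in (_ < X)%N](prednK m0) ltnS.
Qed.

(** The shift of [a s] from its limit comes from the degree already lost when the
    factor is applied, [(d s).+1 <= m] with [B 0] included, divided by [n * m]. *)
Lemma iter_H_Xn : (0 < n)%N -> (0 < m <= j.+1)%N -> b 0 = 1 ->
  exists a : 'I_j -> R,
  (forall s, (b (sigma s).+1 - 1) - n%:R^-1 <= a s <= b (sigma s).+1 - 1) /\
  forall k, (k <= n)%N -> iter k (H n m b sigma) 'X^(n * m) =
    (\prod_(i < k) ((n - i)%N%:R / n%:R) *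
     \prod_(s < j) \prod_(i < k) (1 + a s - n%:R^-1 * i%:R)) *:
    'X^((n - k) * m).
Proof.
move=> n0 mj b0; have /andP[m0 _] := mj.
have nm0 : (n * m)%:R != 0 :> R by rewrite pnatr_eq0 -lt0n muln_gt0 n0 m0.
have nn0 : n%:R != 0 :> R by rewrite pnatr_eq0 -lt0n.
have mm0 : m%:R != 0 :> R by rewrite pnatr_eq0 -lt0n.
have [d [dle dE]] := foldB_Xn (enum_uniq 'I_j).
rewrite count_small// in dle dE.
exists (fun s => b (sigma s).+1 - 1 - (d s).+1%:R / (n * m)%:R); split=> [s|].
  have d0 : 0 <= (d s).+1%:R / (n * m)%:R :> R by rewrite divr_ge0.
  have d1 : (d s).+1%:R / (n * m)%:R <= n%:R^-1 :> R.
    rewrite ler_pdivrMr ?ltr0n ?muln_gt0 ?n0// natrM mulKf//.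
    by rewrite ler_nat -(prednK m0) ltnS.
  by apply/andP; split; lra.
have HX k : (0 < k <= n)%N -> H n m b sigma 'X^(k * m) = (k%:R / n%:R *
   \prod_(s < j) (k%:R / n%:R + (b (sigma s).+1 - 1 - (d s).+1%:R / (n * m)%:R)))
    *: 'X^(k.-1 * m).
  move=> /andP[k0 kn]; have mk : (m <= k * m)%N by rewrite leq_pmull.
  rewrite /H B_Xn; last by rewrite m0 muln_gt0 k0.
  rewrite b0 subrr addr0 m0 -/(foldB _ _) foldBZ dE; last first.
    by rewrite leq_subRL ?muln_gt0 ?k0// add1n prednK.
  rewrite scalerA -subnDA add1n prednK//; congr (_ * _ *: 'X^_).
  - by rewrite !natrM -mulf_div mulfV// mulr1.
  - rewrite big_enum; apply: eq_bigr => s _.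
    have ds : (d s < m)%N by rewrite -(prednK m0) ltnS.
    rewrite -subnDA add1n natrB ?(leq_trans ds)// !natrM.
    by field; rewrite nn0 mm0.
  - by rewrite -subn1 mulnBl mul1n.
elim=> [_|k IH kn].
  by rewrite big_ord0 mul1r big1 ?scale1r ?subn0// => s _; rewrite big_ord0.
rewrite iterS IH 1?ltnW//.
have -> p a : H n m b sigma (a *: p) = a *: H n m b sigma p.
  by rewrite /H BZ -!/(foldB _ _) foldBZ.
rewrite HX ?subn_gt0 ?kn ?leq_subr// scalerA -subnS; congr (_ *: _).
rewrite big_ord_recr /=.
rewrite [in RHS](eq_bigr (fun s => (\prod_(i < k) (1 + (b (sigma s).+1 - 1 -
   (d s).+1%:R / (n * m)%:R) - n%:R^-1 * i%:R)) * ((n - k)%N%:R / n%:R +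
   (b (sigma s).+1 - 1 - (d s).+1%:R / (n * m)%:R)))); last first.
  move=> s _; rewrite big_ord_recr /= natrB 1?ltnW//; congr (_ * _).
  by field; rewrite nn0 mm0.
rewrite [X in _ = _ * X]big_split /=; exact: mulrACA.
Qed.

(** The homogenized form of [rpoly rs], with ['X^m] and [- c] for its variables. *)
Lemma prod_XnsubC_rpoly (c : R) (rs : seq R) :
  \prod_(r <- rs) ('X^m - (c * r)%:P) =
  \sum_(k < (size rs).+1) ((- c) ^+ k * (rpoly rs)`_k) *: 'X^((size rs - k) * m).
Proof.
elim: rs => [|r rs IH].
  by rewrite big_nil big_ord_recl big_ord0 addr0 /rpoly big_nil coef1 mulr1 scale1r mul0n.
have co k : (rpoly (r :: rs))`_k.+1 = (rpoly rs)`_k.+1 + r * (rpoly rs)`_k.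
  by rewrite {1}/rpoly big_cons mulrDl mul1r -scalerAl coefD coefZ coefXM.
rewrite big_cons IH mulrBl [in RHS]big_ord_recl /= expr0 mul1r rpoly_coef0 subn0.
rewrite [in RHS](eq_bigr (fun k : 'I_(size rs).+1 =>
  ((- c) ^+ k.+1 * (rpoly rs)`_k.+1) *: 'X^((size rs - k) * m) -
  (c * r) *: (((- c) ^+ k * (rpoly rs)`_k) *: 'X^((size rs - k) * m)))); last first.
  move=> k _; rewrite /bump add1n subSS co scalerA -scalerBl exprS; congr (_ *: _).
  by ring.
rewrite sumrB -scaler_sumr mul_polyC addrA; congr (_ - _).
rewrite [in RHS]big_ord_recr /= subnn nth_default ?size_rpoly// mulr0 scale0r addr0.
rewrite big_ord_recl /= expr0 mul1r rpoly_coef0 subn0 mulrDr; congr (_ + _).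
  by rewrite !scale1r -exprD -mulSn.
rewrite mulr_sumr; apply: eq_bigr => k _; rewrite /bump add1n -scalerAr -exprD.
by rewrite -mulSn -subSn// subSS.
Qed.

Lemma expH_factor (c : R) : (0 < n)%N -> (0 < m <= j.+1)%N -> b 0 = 1 ->
  (forall s, (1 <= s <= j)%N -> 1 <= b s) ->
  exists (a : 'I_j -> R) (rs : seq R),
  [/\ forall s, (b (sigma s).+1 - 1) - n%:R^-1 <= a s <= b (sigma s).+1 - 1,
      size rs = n, {in rs, forall r, 0 <= r},
      forall k, (rpoly rs)`_k =
        'C(n, k)%:R * \prod_(s < j) \prod_(i < k) (1 + a s - n%:R^-1 * i%:R) &
      expH n m b c sigma = \prod_(r <- rs) ('X^m - (c * r)%:P)].
Proof.
move=> n0 mj b0 b1; have nn0 : n%:R != 0 :> R by rewrite pnatr_eq0 -lt0n.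
have [a [a_b HE]] := iter_H_Xn n0 mj b0.
have [_ /mapP[s _ ->]|rs [srs rs0 rsE]] := @rpoly_multiplier R n (map a (index_enum 'I_j)).
  have /andP[+ _] := a_b s; apply: le_trans; rewrite lerDr subr_ge0 b1//.
  by rewrite /= ltn_ord.
exists a, rs; split=> // [k|]; first by rewrite rsE big_map.
rewrite prod_XnsubC_rpoly srs /expH; apply: eq_bigr => k _.
have kn : (k <= n)%N by rewrite -ltnS.
rewrite HE// scalerA rsE big_map; congr (_ *: _); rewrite mulrA [RHS]mulrA; congr (_ * _).
have kf : k`!%:R != 0 :> R by rewrite pnatr_eq0 -lt0n fact_gt0.
rewrite -mulNr exprMn -!mulrA; congr (_ * _).
rewrite big_split /= -natr_prod -ffact_prod -bin_ffact natrM prodr_const card_ord exprVn.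
by field; rewrite kf expf_neq0.
Qed.

End operators.

(** * Riemann sums of monotone functions *)

Section riemann_sums.
Context {R : realType}.
Local Notation lam := (@lebesgue_measure R).
Local Notation U01 := (uniform_prob (@ltr01 R)).

Lemma nondecreasing_integrable_itv (g : R -> R) (a b : R) :
  nondecreasing_fun g -> (forall x, 0 <= g x <= 1) ->
  lam.-integrable `[a, b[ (EFin \o g).
Proof.
move=> gm g01; apply: measurable_bounded_integrable => //=.
- by rewrite lebesgue_measure_itv; case: ifP => // _; rewrite -EFinD ltry.
- exact: nondecreasing_measurable.
- exists 1; split => // M M1 x _ /=; have /andP[g0 g1] := g01 x.
  by rewrite ger0_norm// (le_trans g1)// ltW.
Qed.

Lemma nondecreasing_Rintegral_bounds (g : R -> R) (a b : R) : a <= b ->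
  nondecreasing_fun g -> (forall x, 0 <= g x <= 1) ->
  g a * (b - a) <= \int[lam]_(x in `[a, b[) g x <= g b * (b - a).
Proof.
move=> ab gm g01.
have mab : fine (lam `[a, b[%classic) = b - a.
  rewrite lebesgue_measure_itv /= lte_fin; case: ltP => //= ba.
  by apply/esym/eqP; rewrite subr_eq0 eq_le ba.
have ic c : lam.-integrable `[a, b[ (EFin \o cst c).
  apply: measurable_bounded_integrable => //=.
  - by rewrite lebesgue_measure_itv; case: ifP => // _; rewrite -EFinD ltry.
  - exists `|c|; split => // M M1 x _ /=; exact: ltW.
rewrite -mab -!Rintegral_cst//; apply/andP; split; apply: le_Rintegral => //=.
- exact: ic.
- exact: nondecreasing_integrable_itv.
- by move=> x /=; rewrite in_itv /= => /andP[ax _]; exact: gm.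
- exact: nondecreasing_integrable_itv.
- exact: ic.
- by move=> x /=; rewrite in_itv /= => /andP[_ xb]; apply: gm; exact: ltW.
Qed.

Lemma Rintegral_itv_split (g : R -> R) (a b c : R) : a <= b -> b <= c ->
  nondecreasing_fun g -> (forall x, 0 <= g x <= 1) ->
  \int[lam]_(x in `[a, c[) g x =
  \int[lam]_(x in `[a, b[) g x + \int[lam]_(x in `[b, c[) g x.
Proof.
move=> ab bc gm g01.
have -> : `[a, c[%classic = `[a, b[%classic `|` `[b, c[%classic.
  rewrite eqEsubset; split => x /=; rewrite !in_itv /=.
    by move=> /andP[ax xc]; have [xb|bx] := ltP x b; [left|right]; rewrite ?ax ?bx.
  move=> [/andP[ax xb]|/andP[bx xc]]; first by rewrite ax (lt_le_trans xb).
  by rewrite xc andbT (le_trans ab).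
rewrite Rintegral_setU//=.
- apply: integrableS (nondecreasing_integrable_itv a c gm g01) => //=.
    by apply: measurableU.
  move=> x /=; rewrite !in_itv /= => -[/andP[ax xb]|/andP[bx xc]].
    by rewrite ax (lt_le_trans xb).
  by rewrite xc andbT (le_trans ab).
- apply/disj_set2P; rewrite -subset0 => x /= [].
  by rewrite !in_itv /= => /andP[_ xb] /andP[]; rewrite leNgt xb.
Qed.

(** The error bound is the same for all monotone functions with values in
    [[0, 1]]; this uniformity later replaces dominated convergence. *)
Lemma monotone_riemann_sum (g : R -> R) (N : nat) : (0 < N)%N ->
  nondecreasing_fun g -> (forall x, 0 <= g x <= 1) ->
  `| \int[U01]_x g x - N%:R^-1 * \sum_(l < N) g (l%:R / N%:R) | <= N%:R^-1.
Proof.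
move=> N0 gm g01.
have NN0 : (N%:R : R) != 0 by rewrite pnatr_eq0 -lt0n.
have -> : \int[U01]_x g x = \int[lam]_(x in `[0, 1[) g x.
  rewrite /Rintegral integral_uniform.
  - rewrite subr0 invr1 mul1e integral_itv_bndo_bndc//.
    by apply/measurable_EFinP; apply: nondecreasing_measurable.
  - by apply/measurable_EFinP; apply: nondecreasing_measurable.
  - by move=> x; rewrite lee_fin; have /andP[] := g01 x.
have key k : N%:R^-1 * \sum_(l < k) g (l%:R / N%:R) <=
    \int[lam]_(x in `[0, k%:R / N%:R[) g x <=
    N%:R^-1 * \sum_(l < k) g (l.+1%:R / N%:R).
  elim: k => [|k /andP[IH1 IH2]].
    by rewrite mul0r set_itvco0 Rintegral_set0 !big_ord0 mulr0 lexx.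
  have kk : k%:R / N%:R <= k.+1%:R / N%:R :> R.
    by rewrite ler_pM2r ?invr_gt0 ?ltr0n// ler_nat.
  have k0 : 0 <= k%:R / N%:R :> R by rewrite divr_ge0.
  rewrite (Rintegral_itv_split k0 kk)//.
  have /andP[] := nondecreasing_Rintegral_bounds kk gm g01.
  have -> : k.+1%:R / N%:R - k%:R / N%:R = N%:R^-1 :> R.
    by rewrite -natr1; ring.
  rewrite !big_ord_recr /= !mulrDr [g _ * _]mulrC [g (k.+1%:R / _) * _]mulrC => h1 h2.
  by apply/andP; split; apply: lerD.
have /andP[k1 k2] := key N; rewrite divff// in k1 k2.
have E : \sum_(l < N) g (l.+1%:R / N%:R) =
    \sum_(l < N) g (l%:R / N%:R) + (g 1 - g 0).
  rewrite addrC; apply/eqP; rewrite -subr_eq -sumrB.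
  rewrite -(big_mkord xpredT (fun l => g (l.+1%:R / N%:R) - g (l%:R / N%:R))).
  by rewrite telescope_sumr// divff// mul0r; apply/eqP.
have g1 : N%:R^-1 * (g 1 - g 0) <= N%:R^-1.
  rewrite ler_piMr ?invr_ge0//; have /andP[_ ?] := g01 1; have /andP[? _] := g01 0.
  by lra.
rewrite E mulrDr in k2; have : (0 : R) <= N%:R^-1 by rewrite invr_ge0.
by rewrite ler_norml => ?; apply/andP; split; lra.
Qed.

End riemann_sums.

(** * Empirical means and their moments *)

Lemma inv1D01 (R : realType) (x : R) : 0 <= x -> 0 <= (1 + x)^-1 <= 1.
Proof. by move=> x0; rewrite invr_ge0 invf_le1 ?addr_ge0 ?ltr_wpDr ?lerDl. Qed.

Definition avg (R : realType) (s : seq R) (h : R -> R) : R :=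
  (size s)%:R^-1 * \sum_(x <- s) h x.

Section averages.
Context {R : realType}.
Implicit Types (s : seq R) (h g : R -> R).

Lemma eq_avg s h g : {in s, h =1 g} -> avg s h = avg s g.
Proof. by move=> hg; congr (_ * _); apply: eq_big_seq. Qed.

Lemma avgD s h g : avg s (fun x => h x + g x) = avg s h + avg s g.
Proof. by rewrite /avg big_split mulrDr. Qed.

Lemma avgZ s a h : avg s (fun x => a * h x) = a * avg s h.
Proof. by rewrite /avg -mulr_sumr mulrCA. Qed.

Lemma avgB s h g : avg s (fun x => h x - g x) = avg s h - avg s g.
Proof. by rewrite /avg sumrB mulrBr. Qed.

Lemma avg_cst s a : (0 < size s)%N -> avg s (fun=> a) = a.
Proof.
move=> s0; rewrite /avg big_const_seq count_predT iter_addr_0 -[a *+ _]mulr_natr.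
by rewrite mulrCA mulVf ?mulr1// pnatr_eq0 -lt0n.
Qed.

Lemma le_avg s h g : {in s, forall x, h x <= g x} -> avg s h <= avg s g.
Proof.
move=> hg; rewrite ler_wpM2l ?invr_ge0// !big_seq; exact: ler_sum.
Qed.

Lemma avg_dist_le s h g k : {in s, forall x, `|h x - g x| <= k x} ->
  `|avg s h - avg s g| <= avg s k.
Proof.
move=> hg; rewrite ler_norml lerBlDr lerBrDr -addrC -!avgD -avgB.
by apply/andP; split; apply: le_avg => x /hg; rewrite ler_norml => /andP[]; lra.
Qed.

Lemma avg_dist s h g e : 0 <= e -> {in s, forall x, `|h x - g x| <= e} ->
  `|avg s h - avg s g| <= e.
Proof.
move=> e0 /avg_dist_le; have [/size0nil->|s0] := posnP (size s).
  by rewrite /avg !big_nil !mulr0 subrr normr0.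
by rewrite avg_cst.
Qed.

Variable r : nat -> seq R.
Hypotheses (r_size : forall n, size (r n) = n)
  (r_ge0 : forall n, {in r n, forall x, 0 <= x}).

Lemma cvg_avg_uniform h :
  (forall e, 0 < e -> exists2 g, cvgn (fun n => avg (r n) g) &
    forall x, 0 <= x -> `|h x - g x| <= e) ->
  cvgn (fun n => avg (r n) h).
Proof.
move=> H; apply/cauchy_cvgP/cauchy_exP => e e0.
have e2 : 0 < e / 2 by rewrite divr_gt0.
have e4 : 0 < e / 4 by rewrite divr_gt0.
have [g cg hg] := H _ e2.
exists (limn (fun n => avg (r n) g)).
have /cvgrPdist_lt/(_ _ e4) := cg; apply: filterS => n /= ng.
rewrite /ball /= [X in X < _](_ : _ = `|(limn (fun n => avg (r n) g) - avg (r n) g) -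
   (avg (r n) h - avg (r n) g)|); last by congr `|_|; ring.
rewrite (le_lt_trans (ler_normB _ _))//.
have : `|avg (r n) h - avg (r n) g| <= e / 2.
  by apply: avg_dist => [|x /r_ge0 /hg]; first exact: ltW.
by lra.
Qed.

(** The functions [x |-> (t + x)^-1] with [t > 0] generate all powers of
    [(1 + x)^-1], by partial fractions and by letting [t] tend to [1]. *)
Lemma cvg_avg_powers :
  (forall t, 0 < t -> cvgn (fun n => avg (r n) (fun x => (t + x)^-1))) ->
  forall k, cvgn (fun n => avg (r n) (fun x => (1 + x)^-1 ^+ k)).
Proof.
move=> H k.
suff [] : cvgn (fun n => avg (r n) (fun x => (1 + x)^-1 ^+ k)) /\
  (forall t, 0 < t -> t != 1 ->
    cvgn (fun n => avg (r n) (fun x => (1 + x)^-1 ^+ k * (t + x)^-1))) by [].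
elim: k => [|k [IHb IHa]].
  split=> [|t t0 _].
    suff : avg (r n) (fun x => (1 + x)^-1 ^+ 0) @[n --> \oo] --> (1 : R) by apply: cvgP.
    apply: cvg_near_cst; exists 1%N => //= n n1.
    by rewrite avg_cst// r_size.
  rewrite (_ : (fun n => _) = (fun n => avg (r n) (fun x => (t + x)^-1))).
    exact: H.
  by apply/funext => n; apply: eq_avg => x _; rewrite expr0 mul1r.
have cvb : cvgn (fun n => avg (r n) (fun x => (1 + x)^-1 ^+ k.+1)).
  apply: cvg_avg_uniform => e e0.
  (* [d <= 1 / 2] keeps [(1 - d + x)^-1] below [2]. *)
  pose d := Num.min (2^-1) (e / 2).
  have d0 : 0 < d by rewrite lt_min divr_gt0// invr_gt0 ltr0n.
  have d12 : d <= 2^-1 by rewrite ge_min lexx.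
  exists (fun x => (1 + x)^-1 ^+ k * (1 - d + x)^-1).
    by apply: IHa; [lra | rewrite lt_eqF//; lra].
  move=> x x0; have x1 : 0 < 1 + x by lra.
  have xd : 0 < 1 - d + x by lra.
  rewrite exprSr -mulrBr normrM.
  have -> : (1 + x)^-1 - (1 - d + x)^-1 = - d * ((1 + x)^-1 * (1 - d + x)^-1).
    by field; rewrite !lt0r_neq0.
  have v1 : (1 + x)^-1 <= 1 by rewrite invf_le1//; lra.
  have v2 : (1 - d + x)^-1 <= 2.
    by rewrite -[2]invrK lef_pV2 ?posrE ?invr_gt0//; lra.
  have : (1 + x)^-1 ^+ k <= 1 by rewrite exprn_ile1// invr_ge0 ltW.
  have de : d <= e / 2 by rewrite ge_min lexx orbT.
  have i1 : 0 <= (1 + x)^-1 by rewrite invr_ge0 ltW.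
  have i2 : 0 <= (1 - d + x)^-1 by rewrite invr_ge0 ltW.
  move=> pk; have p0 : 0 <= (1 + x)^-1 ^+ k by rewrite exprn_ge0.
  have vv0 := mulr_ge0 i1 i2.
  rewrite normrM normrN (ger0_norm p0) (ger0_norm (ltW d0)) (ger0_norm vv0).
  have h1 : (1 + x)^-1 * (1 - d + x)^-1 <= 1 * 2 by exact: ler_pM.
  have h2 : d * ((1 + x)^-1 * (1 - d + x)^-1) <= e / 2 * (1 * 2).
    by apply: ler_pM => //; exact: ltW.
  have h3 : (1 + x)^-1 ^+ k * (d * ((1 + x)^-1 * (1 - d + x)^-1)) <= 1 * (e / 2 * (1 * 2)).
    by apply: ler_pM => //; apply: mulr_ge0 => //; exact: ltW.
  by apply: (le_trans h3); rewrite mul1r mul1r divfK.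
split=> // t t0 t1.
have t10 : t - 1 != 0 by rewrite subr_eq0.
rewrite (_ : (fun n => _) = (fun n => (t - 1)^-1 *
   (avg (r n) (fun x => (1 + x)^-1 ^+ k.+1) -
    avg (r n) (fun x => (1 + x)^-1 ^+ k * (t + x)^-1)))).
  by apply: is_cvgMr; apply: is_cvgB => //; exact: IHa.
apply/funext => n; rewrite -avgB -avgZ; apply: eq_avg => x /r_ge0 x0.
rewrite exprSr -mulrBr -mulrA [RHS]mulrCA; congr (_ * _).
by field; rewrite t10 !lt0r_neq0//; lra.
Qed.

End averages.

(** * Quantile functions and their limits *)

Section bounded_integrals.
Context d {T : measurableType d} {R : realType} (P : probability T R).

Lemma bounded_integrable (g : T -> R) (M : R) :
  measurable_fun setT g -> (forall x, `|g x| <= M) ->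
  P.-integrable setT (EFin \o g).
Proof.
move=> mg gM; apply: measurable_bounded_integrable => //.
  by rewrite /= probability_setT ltry.
exists M; split; first exact: num_real.
by move=> K MK x _; apply: (le_trans (gM x)); rewrite ltW.
Qed.

Lemma Rintegral_dist_le (g h k : T -> R) :
  P.-integrable setT (EFin \o g) -> P.-integrable setT (EFin \o h) ->
  P.-integrable setT (EFin \o k) -> (forall x, `|g x - h x| <= k x) ->
  `|\int[P]_x g x - \int[P]_x h x| <= \int[P]_x k x.
Proof.
move=> ig ih ik gh; have igh := integrableB measurableT ig ih.
rewrite -RintegralB// (le_trans (le_normr_Rintegral _ _))//.
apply: le_Rintegral => //.
exact: (integrable_norm (f := fun x => g x - h x)).
Qed.

Lemma Rintegral_prob_cst (a : R) : \int[P]_x a = a.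
Proof. by rewrite Rintegral_cst//= probability_setT mulr1. Qed.

Lemma Rintegral_dist (g h : T -> R) (e : R) :
  P.-integrable setT (EFin \o g) -> P.-integrable setT (EFin \o h) ->
  (forall x, `|g x - h x| <= e) ->
  `|\int[P]_x g x - \int[P]_x h x| <= e.
Proof.
move=> ig ih /(Rintegral_dist_le ig ih); rewrite Rintegral_prob_cst; apply.
exact: (bounded_integrable (M := `|e|)).
Qed.

Lemma Rintegral_poly (q : T -> R) (p : {poly R}) :
  measurable_fun setT q -> (forall x, 0 <= q x <= 1) ->
  \int[P]_x p.[q x] = \sum_(k < size p) p`_k * \int[P]_x q x ^+ k.
Proof.
move=> mq q01.
have iq k : P.-integrable setT (EFin \o (fun x => q x ^+ k)).
  apply: (@bounded_integrable _ 1); first exact: measurable_funX.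
  move=> x; have /andP[q0 q1] := q01 x.
  by rewrite ger0_norm ?exprn_ge0// exprn_ile1.
under eq_Rintegral do rewrite horner_coef.
elim: (size p) => [|n IH].
  under eq_Rintegral do rewrite big_ord0.
  by rewrite big_ord0 Rintegral_cst// mul0r.
have iZ k : P.-integrable setT (EFin \o (fun x => p`_k * q x ^+ k)).
  by have := integrableZl measurableT p`_k (iq k).
under eq_Rintegral do rewrite big_ord_recr.
rewrite big_ord_recr /= -IH RintegralD//.
  by rewrite RintegralZl.
rewrite (_ : EFin \o _ =
   (fun x => \sum_(k < n) (p`_k * q x ^+ k)%:E)%E).
  apply: (integrable_sum measurableT (index_enum 'I_n) (P := xpredT)
    (h := fun k x => (p`_k * q x ^+ k)%:E)) => k _; exact: iZ.
by apply/funext => x /=; rewrite sumEFin.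
Qed.

End bounded_integrals.

Lemma ultra_cvg_segment (R : realType) (U : set_system nat) (y : nat -> R) (a b : R) :
  UltraFilter U -> (forall n, a <= y n <= b) ->
  exists2 l, a <= l <= b & y n @[n --> U] --> l.
Proof.
move=> UU yab; have PU : ProperFilter U  := @ultra_proper _ _ UU.
have [|l [lab cl]] := @segment_compact R a b (y @ U) _.
  by apply: (@filterE _ U) => n /=; rewrite in_itv /=.
exists l; first by move: lab; rewrite /= in_itv.
move=> B lB; have [//|UB] := in_ultra_setVsetC (y @^-1` B) UU.
by have [z [nBz Bz]] := cl (~` B) B UB lB.
Qed.

Lemma cvg_exprn (R : realType) (F : set_system nat) (y : nat -> R) (l : R) (k : nat) :
  Filter F -> y n @[n --> F] --> l -> y n ^+ k @[n --> F] --> l ^+ k.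
Proof.
move=> FF yl; elim: k => [|k IH]; first exact: cvg_cst.
by rewrite exprS; under eq_fun do rewrite exprS; exact: cvgM.
Qed.

Section quantiles.
Context {R : realType}.
Local Notation U01 := (uniform_prob (@ltr01 R)).
Implicit Types s : seq R.

(** The change of variable [x |-> (1 + x)^-1] maps [[0, +oo]] onto [[0, 1]], so that no
    mass can escape to infinity; mass that would do so gathers at [0]. *)
Definition compactified s : seq R := sort <=%R (map (fun x => (1 + x)^-1) s).

(** The quantile function of the empirical distribution of [compactified s];
    the default value [1] keeps it nondecreasing beyond the last entry. *)
Definition quantile s (u : R) : R :=
  nth 1 (compactified s) (Num.truncn ((size s)%:R * u)).

Lemma size_compactified s : size (compactified s) = size s.
Proof. by rewrite size_sort size_map. Qed.

Lemma compactified01 s : {in s, forall x, 0 <= x} ->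
  {in compactified s, forall v, 0 <= v <= 1}.
Proof.
by move=> s0 v; rewrite mem_sort => /mapP[x /s0 x0 ->]; exact: inv1D01.
Qed.

Lemma nth_compactified01 s i : {in s, forall x, 0 <= x} ->
  0 <= nth 1 (compactified s) i <= 1.
Proof.
move=> s0; have [il|il] := ltnP i (size (compactified s)).
  by apply: (compactified01 s0); rewrite mem_nth.
by rewrite nth_default// lexx ler01.
Qed.

Lemma quantile_nd s : {in s, forall x, 0 <= x} -> nondecreasing_fun (quantile s).
Proof.
move=> s0 u v uv; rewrite /quantile.
set i := Num.truncn _; set k := Num.truncn _.
have ik : (i <= k)%N by apply: le_truncn; rewrite ler_wpM2l.
have [kl|kl] := ltnP k (size (compactified s)); last first.
  by rewrite [leRHS]nth_default//; have /andP[] := nth_compactified01 i s0.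
by apply: sorted_leq_nth; rewrite ?inE ?(leq_ltn_trans ik)//;
  [exact: le_trans | exact: sort_le_sorted].
Qed.

Lemma avg_quantile s (h : R -> R) : (0 < size s)%N ->
  avg s (fun x => h (1 + x)^-1) =
  (size s)%:R^-1 * \sum_(l < size s) h (quantile s (l%:R / (size s)%:R)).
Proof.
move=> s0; congr (_ * _).
transitivity (\sum_(v <- compactified s) h v).
  by rewrite (perm_big _ (permEl (perm_sort _ _))) big_map.
rewrite (big_nth 1) big_mkord size_compactified; apply: eq_bigr => l _.
by rewrite /quantile mulrCA mulfV ?mulr1 ?natrK// pnatr_eq0 -lt0n.
Qed.

(** Helly's selection theorem in a form without subsequences: the quantile
    functions converge pointwise along an ultrafilter finer than [\oo], and their
    powers being monotone, the integrals follow by comparison with Riemann sums.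
    The limit of the integrals along [\oo] exists by assumption, hence is the one
    found along the ultrafilter. *)
Lemma limit_quantile (r : nat -> seq R) :
  (forall n, size (r n) = n) -> (forall n, {in r n, forall x, 0 <= x}) ->
  (forall k, cvgn (fun n => avg (r n) (fun x => (1 + x)^-1 ^+ k))) ->
  exists q : R -> R, [/\ nondecreasing_fun q, forall u, 0 <= q u <= 1 &
    forall k, avg (r n) (fun x => (1 + x)^-1 ^+ k) @[n --> \oo] -->
      \int[U01]_u q u ^+ k].
Proof.
move=> rs r0 rc.
have [U [UU ooU]] : exists U : set_system nat, UltraFilter U /\ \oo `<=` U.
  exact: ultraFilterLemma.
have PU : ProperFilter U  := @ultra_proper _ _ UU.
have /choice[q qP] : forall u, exists l : R, 0 <= l <= 1 /\
    quantile (r n) u @[n --> U] --> l.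
  move=> u; have [|l l01 ql] := @ultra_cvg_segment R U (fun n => quantile (r n) u) 0 1 UU.
    by move=> n; exact: nth_compactified01.
  by exists l.
have q01 u : 0 <= q u <= 1 by have [] := qP u.
have qnd : nondecreasing_fun q.
  move=> u v uv; have [_ cu] := qP u; have [_ cv] := qP v.
  apply: (ler_cvg_to cu cv); apply: (@filterE _ U) => n; exact: quantile_nd.
exists q; split => // k; set L := limn (fun n => avg (r n) (fun x => (1 + x)^-1 ^+ k)).
have cL : avg (r n) (fun x => (1 + x)^-1 ^+ k) @[n --> \oo] --> L := rc k.
suff <- : L = \int[U01]_u q u ^+ k by [].
have pnd (g : R -> R) : nondecreasing_fun g -> (forall x, 0 <= g x <= 1) ->
    nondecreasing_fun (fun u => g u ^+ k) /\ (forall x, 0 <= g x ^+ k <= 1).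
  move=> gn g01; split=> [u v uv|u]; have /andP[gu0 gu1] := g01 u.
    by rewrite lerXn2r ?nnegrE ?gn//; have /andP[] := g01 v.
  by rewrite exprn_ge0//= exprn_ile1.
have key N : (0 < N)%N -> `|L - \int[U01]_u q u ^+ k| <= 3 / N%:R.
  move=> N0.
  have S1 : `|L - N%:R^-1 * \sum_(l < N) q (l%:R / N%:R) ^+ k| <= 2 / N%:R.
    have cq (l : nat) : quantile (r n) (l%:R / N%:R) ^+ k @[n --> U] -->
        q (l%:R / N%:R) ^+ k.
      have [_ cl] := qP (l%:R / N%:R).
      exact: cvg_exprn cl.
    have c1 : `|avg (r n) (fun x => (1 + x)^-1 ^+ k) -
        N%:R^-1 * \sum_(l < N) quantile (r n) (l%:R / N%:R) ^+ k| @[n --> U] -->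
        `|L - N%:R^-1 * \sum_(l < N) q (l%:R / N%:R) ^+ k|.
      apply: cvg_norm; apply: cvgB.
        by apply: cvg_trans cL; exact: cvg_app.
      apply: cvgMr; apply: cvg_big => [|l _]; first exact: add_continuous.
      exact: cq.
    apply: (ler_cvg_to c1 (cvg_cst _)).
    apply: ooU; exists N => // n /= Nn.
    have n0 : (0 < n)%N by exact: leq_trans Nn.
    have [gn g01] := pnd _ (quantile_nd (@r0 n)) (fun u => nth_compactified01 _ (@r0 n)).
    (* With mesh [1 / n] the Riemann sum is the empirical mean itself. *)
    have m1 := monotone_riemann_sum N0 gn g01.
    have m2 := monotone_riemann_sum n0 gn g01.
    rewrite (avg_quantile (fun v => v ^+ k)) ?rs//.
    have : n%:R^-1 <= N%:R^-1 :> R by rewrite lef_pV2 ?posrE ?ltr0n// ler_nat.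
    move: m1 m2; rewrite !ler_norml => /andP[? ?] /andP[? ?] ?.
    by apply/andP; split; lra.
  have [gn g01] := pnd _ qnd q01.
  have := monotone_riemann_sum N0 gn g01; move: S1.
  by rewrite !ler_norml => /andP[? ?] /andP[? ?]; apply/andP; split; lra.
apply/eqP; rewrite -subr_eq0 -normr_le0 leNgt; apply/negP => d0.
set dd := `|L - _| in key d0.
have := key (Num.truncn (3 / dd)).+1 isT.
rewrite ler_pdivlMr ?ltr0n// => h.
have : 3 / dd < (Num.truncn (3 / dd)).+1%:R by exact: truncnS_gt.
by rewrite ltr_pdivrMr// mulrC ltNge h.
Qed.

End quantiles.

(** * Approximation by Bernstein polynomials *)

Section bernstein.
Context {R : realType}.

(** The Bernstein operator of degree [N]: the expectation of [f] at the number
    of successes of [N] independent trials with success probability ['X]. *)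
Fixpoint bernstein (N : nat) (f : nat -> R) : {poly R} :=
  if N is N'.+1 then
    (1 - 'X) * bernstein N' f + 'X * bernstein N' (fun k => f k.+1)
  else (f 0%N)%:P.

Lemma horner_bernsteinS N f (v : R) : (bernstein N.+1 f).[v] =
  (1 - v) * (bernstein N f).[v] + v * (bernstein N (fun k => f k.+1)).[v].
Proof. by rewrite /= !hornerE. Qed.

Lemma bernstein_le N f g (v : R) : 0 <= v <= 1 ->
  (forall k, (k <= N)%N -> f k <= g k) ->
  (bernstein N f).[v] <= (bernstein N g).[v].
Proof.
move=> /andP[v0 v1]; elim: N f g => [|N IH] f g fg.
  by rewrite /= !hornerC fg.
rewrite !horner_bernsteinS lerD// ler_wpM2l ?subr_ge0// IH// => k kN; apply: fg => //.
exact: leqW.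
Qed.

(** The shift in the recursion moves the centre [c] by one, so a statement for
    all [c] goes through by induction; at [c = N * v] it is the variance formula. *)
Lemma bernstein_quadratic N (a b c v : R) :
  (bernstein N (fun k => a + b * (k%:R - c) ^+ 2)).[v] =
  a + b * ((N%:R * v - c) ^+ 2 + N%:R * v * (1 - v)).
Proof.
elim: N c => [|N IH] c; first by rewrite /= hornerC; ring.
rewrite horner_bernsteinS IH.
have -> : (fun k => a + b * (k.+1%:R - c) ^+ 2) =
    (fun k => a + b * (k%:R - (c - 1)) ^+ 2).
  by apply/funext => k; rewrite -natr1; ring.
by rewrite IH -natr1; ring.
Qed.

Lemma uniformly_continuous01 (h : R -> R) (e : R) : continuous h -> 0 < e ->
  exists2 d, 0 < d & forall x y, 0 <= x <= 1 -> `|x - y| < d -> `|h x - h y| < e.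
Proof.
move=> ch e0; have e2 : 0 < e / 2 by rewrite divr_gt0.
have /compact_near_coveringP cK := @segment_compact R 0 1.
pose P (d x : R) := 0 < d -> forall y, `|x - y| < d -> `|h x - h y| < e.
have : \forall d \near (0 : R)^'+, `[0, 1]%classic `<=` P d.
  apply: cK => x _; have /cvgrPdist_lt/(_ _ e2)/nbhs_ballP[d /= d0 dh] := ch x.
  exists (ball x (d / 2), [set d' | d' < d / 2]) => /=.
    split; first by apply: nbhsx_ballx; rewrite divr_gt0.
    by apply: nbhs_right_lt; rewrite divr_gt0.
  move=> [x' d'] /= [xx' d'd] d'0 y x'y.
  have h1 : `|h x - h x'| < e / 2 by apply: dh; apply: (lt_le_trans xx'); lra.
  have h2 : `|h x - h y| < e / 2.
    apply: dh; rewrite /ball /= (_ : x - y = (x - x') + (x' - y)); last by ring.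
    by rewrite (le_lt_trans (ler_normD _ _))//; rewrite /ball /= in xx'; lra.
  rewrite (_ : h x' - h y = (h x - h y) - (h x - h x')); last by ring.
  by rewrite (le_lt_trans (ler_normB _ _))//; lra.
rewrite /at_right => /nbhs_ballP[d /= d0 dP].
have d2 : 0 < d / 2 by rewrite divr_gt0.
exists (d / 2) => // x y x01 xy.
have bd : ball (0 : R) d (d / 2).
  by rewrite /ball /= sub0r normrN gtr0_norm// ltr_pdivrMr// ltr_pMr// ltr1n.
apply: (dP _ bd d2 x _ d2 y xy).
by rewrite /= in_itv.
Qed.

(** Bernstein's proof: [h] varies by at most [e / 2] within distance [d], and beyond
    it the bound [2 * M] is dominated by a multiple of the squared distance. *)
Lemma weierstrass01 (h : R -> R) (M e : R) : continuous h ->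
  (forall x, `|h x| <= M) -> 0 < e ->
  exists p : {poly R}, forall v, 0 <= v <= 1 -> `|h v - p.[v]| <= e.
Proof.
move=> ch hM e0; have e2 : 0 < e / 2 by rewrite divr_gt0.
have [d d0 dh] := uniformly_continuous01 ch e2.
have M0 : 0 <= M by rewrite (le_trans _ (hM 0)).
(* This [N] makes [2 * M / d ^+ 2] times the variance [v * (1 - v) / N] small. *)
pose N := (Num.truncn (4 * M / (d ^+ 2 * e))).+1.
have N0 : 0 < N%:R :> R by rewrite ltr0n.
have NM : 4 * M / (d ^+ 2 * e) <= N%:R.
  by rewrite ltW// truncnS_gt.
pose f k := h (k%:R / N%:R); exists (bernstein N f) => v v01.
pose C := 2 * M / (d ^+ 2 * N%:R ^+ 2).
have C0 : 0 <= C by rewrite divr_ge0 ?mulr_ge0// ?exprn_ge0// ltW.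
have CN : C * (N%:R * v * (1 - v)) <= e / 2.
  have /andP[v0 v1] := v01.
  have -> : C * (N%:R * v * (1 - v)) = (2 * M / d ^+ 2 / N%:R) * (v * (1 - v)).
    by rewrite /C; field; rewrite !lt0r_neq0.
  have vv : v * (1 - v) <= 1 * 1 by apply: ler_pM => //; lra.
  have K0 : 0 <= 2 * M / d ^+ 2 / N%:R.
    by rewrite !divr_ge0// ?mulr_ge0// ?exprn_ge0// ltW.
  apply: (le_trans (ler_wpM2l K0 vv)); rewrite !mulr1 ler_pdivrMr//.
  have := ler_wpM2r (ltW e2) NM.
  have -> : 4 * M / (d ^+ 2 * e) * (e / 2) = 2 * M / d ^+ 2.
    by field; rewrite !lt0r_neq0.
  by rewrite [X in _ <= X -> _]mulrC.
have fk k : `|h v - f k| <= e / 2 + C * (k%:R - N%:R * v) ^+ 2.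
  have [vk|vk] := ltP `|v - k%:R / N%:R| d.
    rewrite (le_trans (ltW (dh _ _ v01 vk)))// lerDl mulr_ge0// sqr_ge0//.
  rewrite (le_trans (ler_normB _ _))//.
  have := hM v; have := hM (k%:R / N%:R); rewrite -/(f k).
  have E : (k%:R - N%:R * v) ^+ 2 = N%:R ^+ 2 * `|v - k%:R / N%:R| ^+ 2.
    by rewrite real_normK ?num_real// -exprMn; field; rewrite lt0r_neq0.
  have : 2 * M <= C * (k%:R - N%:R * v) ^+ 2.
    rewrite E; have -> : C * (N%:R ^+ 2 * `|v - k%:R / N%:R| ^+ 2) =
      2 * M / d ^+ 2 * `|v - k%:R / N%:R| ^+ 2.
      by rewrite /C; field; rewrite !lt0r_neq0.
    rewrite mulrAC ler_pdivlMr ?exprn_gt0// ler_wpM2l ?mulr_ge0//.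
    by rewrite ler_pXn2r// nnegrE ltW.
  by lra.
have up : (bernstein N f).[v] <= h v + e / 2 + C * (N%:R * v * (1 - v)).
  have := @bernstein_le N f (fun k => (h v + e / 2) + C * (k%:R - N%:R * v) ^+ 2) v v01.
  rewrite bernstein_quadratic subrr expr0n /= add0r; apply => k _.
  by have := fk k; rewrite ler_norml => /andP[]; lra.
have lo : h v - e / 2 - C * (N%:R * v * (1 - v)) <= (bernstein N f).[v].
  have := @bernstein_le N (fun k => (h v - e / 2) + (- C) * (k%:R - N%:R * v) ^+ 2) f v v01.
  rewrite bernstein_quadratic subrr expr0n /= add0r mulNr; apply => k _.
  by have := fk k; rewrite ler_norml => /andP[]; lra.
by rewrite ler_norml; apply/andP; split; lra.
Qed.

End bernstein.

(** * Weak convergence from convergence of resolvents *)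

Lemma ler_dist3 (R : realFieldType) (a b a' b' e : R) :
  `|a - a'| <= e / 3 -> `|a' - b'| <= e / 3 -> `|b - b'| <= e / 3 -> `|a - b| <= e.
Proof.
rewrite !ler_norml => /andP[? ?] /andP[? ?] /andP[? ?].
by apply/andP; split; lra.
Qed.

Section weak_limit.
Context {R : realType}.
Local Notation U01 := (uniform_prob (@ltr01 R)).
Variable r : nat -> seq R.
Hypotheses (r_size : forall n, size (r n) = n)
  (r_ge0 : forall n, {in r n, forall x, 0 <= x}).

Lemma cvg_avg_poly (q : R -> R) (p : {poly R}) : measurable_fun setT q ->
  (forall u, 0 <= q u <= 1) ->
  (forall k, avg (r n) (fun x => (1 + x)^-1 ^+ k) @[n --> \oo] -->
     \int[U01]_u q u ^+ k) ->
  avg (r n) (fun x => p.[(1 + x)^-1]) @[n --> \oo] --> \int[U01]_u p.[q u].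
Proof.
move=> mq q01 qk; rewrite Rintegral_poly//.
rewrite (_ : (fun n => _) = (fun n => \sum_(k < size p)
    p`_k * avg (r n) (fun x => (1 + x)^-1 ^+ k))).
  apply: cvg_big => [|k _]; first exact: add_continuous.
  by apply: cvgMr; exact: qk.
apply/funext => n; rewrite /avg; under eq_bigr do rewrite horner_coef.
rewrite exchange_big mulr_sumr; apply: eq_bigr => k _ /=.
by rewrite -mulr_sumr mulrCA.
Qed.

Lemma cvg_avg_continuous (q h : R -> R) (M : R) : measurable_fun setT q ->
  (forall u, 0 <= q u <= 1) ->
  (forall k, avg (r n) (fun x => (1 + x)^-1 ^+ k) @[n --> \oo] -->
     \int[U01]_u q u ^+ k) ->
  continuous h -> (forall v, `|h v| <= M) ->
  avg (r n) (fun x => h (1 + x)^-1) @[n --> \oo] --> \int[U01]_u h (q u).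
Proof.
move=> mq q01 qk ch hM; apply/cvgrPdist_le => e e0.
have e3 : 0 < e / 3 by rewrite divr_gt0.
have [p ph] := weierstrass01 ch hM e3.
have /cvgrPdist_le/(_ _ e3) := cvg_avg_poly (p := p) mq q01 qk.
apply: filterS => n pn.
have d1 : `|avg (r n) (fun x => h (1 + x)^-1) - avg (r n) (fun x => p.[(1 + x)^-1])| <= e / 3.
  by apply: avg_dist => [|x /r_ge0 x0]; [exact: ltW | rewrite ph// inv1D01].
have d2 : `|\int[U01]_u h (q u) - \int[U01]_u p.[q u]| <= e / 3.
  apply: Rintegral_dist => [||u]; last exact: ph.
    apply: (bounded_integrable U01 (M := M)) => //.
    exact: measurableT_comp (continuous_measurable_fun ch) mq.
  have hp u : `|p.[q u]| <= M + e / 3.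
    have := ph _ (q01 u); have := hM (q u).
    by rewrite !ler_norml => /andP[? ?] /andP[? ?]; apply/andP; split; lra.
  apply: (bounded_integrable U01 _ hp).
  apply: measurableT_comp mq; apply: continuous_measurable_fun.
  exact: continuous_horner.
exact: ler_dist3 d2 pn d1.
Qed.

Let cutoff (K v : R) : R := Num.min 1 (Num.max 0 (K * v)).

Lemma continuous_cutoff K : continuous (cutoff K).
Proof.
move=> v; apply: (@continuous_min R R (fun=> 1) (fun w => Num.max 0 (K * w))).
  exact: cst_continuous.
apply: (@continuous_max R R (fun=> 0) (fun w => K * w)); first exact: cst_continuous.
exact: mulrl_continuous.
Qed.

Lemma cutoff01 K v : 0 <= cutoff K v <= 1.
Proof. by rewrite /cutoff le_min ler01 le_max lexx /= ge_min lexx. Qed.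

(** Under [v = (1 + x)^-1], functions of [- x] become functions on [(0, 1]];
    the factor [cutoff K] extends them continuously by [0] at the end [v = 0],
    which corresponds to [- x] tending to [-oo]. *)
Lemma continuous_cutoff_comp (f : R -> R) (K M : R) : 0 < K ->
  continuous f -> (forall z, `|f z| <= M) ->
  continuous (fun v : R => f (Num.min 0 (1 - v^-1)) * cutoff K v).
Proof.
move=> K0 cf fM v; have [v0|v0] := ltP 0 v.
  apply: continuousM; last exact: continuous_cutoff.
  apply: continuous_comp; last exact: cf.
  apply: (@continuous_min R R (fun=> 0) (fun w => 1 - w^-1)).
    exact: cst_continuous.
  apply: continuousB; first exact: cst_continuous.
  by apply: inv_continuous; rewrite gt_eqF.
have cv0 : cutoff K v = 0.
  by rewrite /cutoff (max_idPl _) ?(min_idPr _) ?ler01// pmulr_rle0.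
rewrite /continuous_at cv0 mulr0.
apply/cvgrPdist_lt => e e0.
have M0 : 0 <= M by rewrite (le_trans _ (fM 0)).
have eM : 0 < e / (M + 1) by rewrite divr_gt0// ltr_wpDl.
have /cvgrPdist_lt/(_ _ eM) := @continuous_cutoff K v.
rewrite cv0; apply: filterS => w; rewrite !sub0r !normrN => cw.
rewrite normrM (le_lt_trans (ler_wpM2r _ (fM _)))//.
have := cw; rewrite ltr_pdivlMr ?ltr_wpDl// mulrDr mulr1 mulrC => /le_lt_trans; apply.
by rewrite lerDl.
Qed.

(** Turns the tightness condition, which is stated with the resolvent, into one
    for [cutoff K]. *)
Lemma cutoff_resolvent (K t x : R) : 1 < K -> 0 < t -> 0 <= x ->
  t * (t + x)^-1 - t / (t + (K - 1)) <= cutoff K (1 + x)^-1.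
Proof.
move=> K1 t0 x0; have tx : 0 < t + x by lra.
have tK : 0 < t + (K - 1) by lra.
have [xK|xK] := leP x (K - 1).
  have -> : cutoff K (1 + x)^-1 = 1.
    have K1x : 1 <= K * (1 + x)^-1 by rewrite ler_pdivlMr; lra.
    by rewrite /cutoff (max_idPr _) ?(min_idPl _)// (le_trans _ K1x).
  have h1 : t * (t + x)^-1 <= 1 by rewrite ler_pdivrMr//; lra.
  have h2 : 0 <= t / (t + (K - 1)) by rewrite divr_ge0// ltW.
  by lra.
have /andP[c0 _] := cutoff01 K (1 + x)^-1; apply: le_trans c0.
by rewrite subr_le0 ler_pM2l// lef_pV2 ?posrE//; lra.
Qed.

(** A continuity theorem for Cauchy transforms on the negative half-line:
    [avg (r n)] is the expectation under the empirical measure of the points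
    [- x], and the convergence of the transforms at every [t > 0], together with
    the tightness condition, gives weak convergence to the law of some [Z]. *)
Theorem weak_limit_of_resolvents :
  (forall t, 0 < t -> cvgn (fun n => avg (r n) (fun x => (t + x)^-1))) ->
  (forall e, 0 < e -> exists2 t, 0 < t &
    \forall n \near \oo, 1 - e <= avg (r n) (fun x => t * (t + x)^-1)) ->
  exists Z : R -> R, [/\ measurable_fun setT Z, forall u, Z u <= 0 &
    forall (f : R -> R) (M : R), continuous f -> (forall z, `|f z| <= M) ->
      avg (r n) (fun x => f (- x)) @[n --> \oo] --> \int[U01]_u f (Z u)].
Proof.
move=> Hc Ht; have mom := cvg_avg_powers r_size r_ge0 Hc.
have [q [qnd q01 qk]] := limit_quantile r_size r_ge0 mom.
have mq : measurable_fun setT q by exact: nondecreasing_measurable.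
have mZ : measurable_fun setT (fun u => Num.min 0 (1 - (q u)^-1)).
  apply: measurable_minr; first exact: measurable_cst.
  apply: measurable_funB; first exact: measurable_cst.
  rewrite (_ : (fun u => (q u)^-1) = (fun u => q u `^ (-1))).
    exact: measurableT_comp (measurable_powR _) mq.
  by apply/funext => u; rewrite powR_inv1//; have /andP[] := q01 u.
(* The minimum with [0] only matters where [q] vanishes. *)
exists (fun u => Num.min 0 (1 - (q u)^-1)); split => // [u|f M cf fM].
  by rewrite ge_min lexx.
have M0 : 0 <= M by rewrite (le_trans _ (fM 0)).
apply/cvgrPdist_le => e e0.
(* Replacing [f] by its product with the cutoff costs [M * (2 * e1) <= e / 3], both
   in the empirical mean and in the integral. *)
pose e1 := e / (6 * (M + 1)).
have M1 : 0 < M + 1 by rewrite ltr_wpDl.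
have e10 : 0 < e1 by rewrite divr_gt0// mulr_gt0.
have Me1 : M * (2 * e1) <= e / 3.
  have -> : e / 3 = (M + 1) * (2 * e1) by rewrite /e1; field; rewrite lt0r_neq0.
  by rewrite ler_wpM2r// ?lerDl// mulr_ge0// ltW.
have [t t0 tn] := Ht _ e10.
(* With this [K] the error term of [cutoff_resolvent] is below [e1]. *)
pose K := 1 + t / e1; have K1 : 1 < K by rewrite ltrDl divr_gt0.
have K0 : 0 < K by exact: lt_trans K1.
have tK : t / (t + (K - 1)) <= e1.
  have te : 0 < t + t / e1 by apply: addr_gt0 => //; exact: divr_gt0.
  rewrite /K [1 + _]addrC addrK ler_pdivrMr//.
  by rewrite mulrDr mulrCA divff ?gt_eqF// mulr1 lerDr mulr_ge0// ltW.
have cut_ge x : 0 <= x -> t * (t + x)^-1 - e1 <= cutoff K (1 + x)^-1.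
  move=> x0; apply: le_trans (cutoff_resolvent K1 t0 x0).
  by rewrite lerD2l lerN2; exact: tK.
have avg_cut : \forall n \near \oo,
    1 - 2 * e1 <= avg (r n) (fun x => cutoff K (1 + x)^-1).
  apply: filterS2 (nbhs_infty_gt 0) tn => n n0 h1.
  have : avg (r n) (fun x => t * (t + x)^-1 - e1) <= avg (r n) (fun x => cutoff K (1 + x)^-1).
    by apply: le_avg => x /r_ge0; exact: cut_ge.
  by rewrite avgB avg_cst ?r_size//; move: h1; lra.
have c1 v : `|cutoff K v| <= 1.
  by have /andP[? ?] := cutoff01 K v; rewrite ger0_norm.
have int_cut : 1 - 2 * e1 <= \int[U01]_u cutoff K (q u).
  have := cvg_avg_continuous mq q01 qk (@continuous_cutoff K) c1.
  by move=> /(ler_cvg_to (cvg_cst (1 - 2 * e1))); exact.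
pose h (v : R) := f (Num.min 0 (1 - v^-1)) * cutoff K v.
have hM v : `|h v| <= M by rewrite normrM -[M]mulr1 ler_pM.
have ch : continuous h := continuous_cutoff_comp K0 cf fM.
have e3 : 0 < e / 3 by rewrite divr_gt0.
have /cvgrPdist_le/(_ _ e3) := cvg_avg_continuous mq q01 qk ch hM.
apply: filterS3 (nbhs_infty_gt 0) avg_cut => n n0 acut hn.
have mcut : measurable_fun setT (fun u => cutoff K (q u)).
  exact: measurableT_comp (continuous_measurable_fun (@continuous_cutoff K)) mq.
have icut := bounded_integrable U01 mcut (fun u => c1 (q u)).
have mh : measurable_fun setT (fun u => h (q u)).
  exact: measurableT_comp (continuous_measurable_fun ch) mq.
have ih := bounded_integrable U01 mh (fun u => hM (q u)).
have mf : measurable_fun setT (fun u => f (Num.min 0 (1 - (q u)^-1))).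
  exact: measurableT_comp (continuous_measurable_fun cf) mZ.
have if' := bounded_integrable U01 mf (fun u => fM _).
have fc z v : `|f z - f z * cutoff K v| <= M - M * cutoff K v.
  have /andP[? ?] := cutoff01 K v.
  rewrite -[f z as X in X - _]mulr1 -mulrBr normrM -[M as X in X - _]mulr1 -mulrBr.
  by rewrite ler_pM// ger0_norm// subr_ge0.
have icM : U01.-integrable setT (EFin \o (fun u => M * cutoff K (q u))).
  by have := integrableZl measurableT M icut.
have iM : U01.-integrable setT (EFin \o (fun=> M)).
  by apply: (bounded_integrable U01 (M := M)) => // u; rewrite ger0_norm.
apply: (ler_dist3 _ hn).
  have iMM := integrableB measurableT iM icM.
  apply: (le_trans (Rintegral_dist_le (P := U01) (k := fun u => M - M * cutoff K (q u))
    if' ih iMM (fun u => fc _ (q u)))).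
  rewrite RintegralB// RintegralZl// Rintegral_prob_cst.
  apply: le_trans Me1; rewrite -[M as X in X - _]mulr1 -mulrBr ler_wpM2l//.
  by move: int_cut; lra.
apply: le_trans Me1.
have MK : avg (r n) (fun x => M - M * cutoff K (1 + x)^-1) <= M * (2 * e1).
  rewrite avgB avgZ avg_cst ?r_size// -[M as X in X - _]mulr1 -mulrBr.
  by rewrite ler_wpM2l//; move: acut; lra.
have hx x : x \in r n -> `|f (- x) - h (1 + x)^-1| <= M - M * cutoff K (1 + x)^-1.
  move=> /r_ge0 x0; rewrite /h invrK opprD addrA subrr sub0r.
  by rewrite (min_idPr _) ?oppr_le0.
by apply: le_trans MK; exact: avg_dist_le.
Qed.

End weak_limit.

(** * Borel measures and root measures *)

Lemma continuous_exprn_num (K : numFieldType) (m : nat) :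
  continuous (fun z : K^o => z ^+ m : K^o).
Proof.
move=> z; elim: m => [|m IH]; first exact: cst_continuous.
rewrite (_ : (fun z : K^o => z ^+ m.+1 : K^o) = (fun z : K^o => z * z ^+ m)).
  by apply: (@continuousM K K^o id (fun z : K^o => z ^+ m)); [exact: cvg_id|exact: IH].
by apply/funext => w; rewrite exprS.
Qed.

Lemma continuous_N_exprn_div (K : numFieldType) (m : nat) (a : K) :
  continuous (fun z : K^o => - z ^+ m / a : K^o).
Proof.
move=> z; apply: (@continuousM K K^o (fun z : K^o => - z ^+ m) (fun=> a^-1));
  last exact: cst_continuous.
by apply: (@continuousN K K^o K^o (fun z : K^o => z ^+ m)); exact: continuous_exprn_num.
Qed.

Section borel.
Context {R : realType}.

Lemma measurable_borel_real (T : ptopologicalType) (f : T -> R) : continuous f ->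
  measurable_fun [set: borel T] (f : borel T -> measurableTypeR R).
Proof.
move=> cf; apply: (measurability (@RGenOpens.G R)).
  exact: RGenOpens.measurableE.
move=> _ [_ [x [y ->]] <-]; rewrite setTI; apply: sub_sigma_algebra.
by move/continuousP : cf; apply; exact: interval_open.
Qed.

Lemma measurable_borel (T U : ptopologicalType) (f : T -> U) : continuous f ->
  measurable_fun [set: borel T] (f : borel T -> borel U).
Proof.
move=> cf; apply: (measurability (@open U : set (set (borel U)))) => // _ [B oB <-].
by rewrite setTI; apply: sub_sigma_algebra; move/continuousP : cf; exact.
Qed.

Lemma continuous_real_complex : continuous (real_complex R : R -> R[i]^o).
Proof.
move=> x; apply/cvgrPdist_lt => e e0.
case: e e0 => er ei; rewrite ltcE /= => /andP[/eqP-> er0].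
have /cvgrPdist_lt/(_ _ er0) : y @[y --> x] --> x by exact: cvg_id.
apply: filterS => y xy; rewrite -rmorphB normc_def /= expr0n addr0 sqrtr_sqr.
by rewrite -/(er%:C) ltcR.
Qed.

Lemma measurable_real_complex :
  measurable_fun setT (real_complex R : measurableTypeR R -> borelC R).
Proof.
apply: (measurability (@open R[i]^o : set (set (borelC R)))) => // _ [B oB <-].
rewrite setTI; apply: open_measurable.
by move/continuousP : continuous_real_complex; exact.
Qed.

End borel.

Lemma integral_pushforwardE (R : realType) (d d' : measure_display)
    (T1 : measurableType d) (T2 : measurableType d')
    (m : {measure set T1 -> \bar R}) (f : T1 -> T2) (g : T2 -> \bar R) :
  measurable_fun setT f ->
  (\int[pushforward m f]_x g x =
   \int[pushforward m f]_x g^\+ x - \int[pushforward m f]_x g^\- x)%E.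
Proof.
move=> mf; pose f' : {mfun T1 >-> T2} := mfun_Sub (mem_set mf).
exact: (integralE (pushforward m f') setT g).
Qed.

Lemma maxr0_subN (R : realDomainType) (a : R) : Num.max a 0 - Num.max (- a) 0 = a.
Proof.
have [h|/ltW h] := leP 0 a.
  by rewrite (max_idPr _) ?subr0// oppr_le0.
by rewrite (max_idPl _) ?oppr_ge0// sub0r opprK.
Qed.

Section root_measure.
Context {R : realType}.

Lemma XnsubC_splits (m : nat) (a : R[i]) : (0 < m)%N ->
  exists s : seq R[i], [/\ size s = m, {in s, forall z, z ^+ m = a} &
    'X^m - a%:P = \prod_(z <- s) ('X - z%:P)].
Proof.
move=> m0; have [s sE] := closed_field_poly_normal ('X^m - a%:P).
have mon : lead_coef ('X^m - a%:P) = 1.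
  by apply/monicP; rewrite monicXnsubC.
rewrite mon scale1r in sE; exists s; split => // [|z zs].
  have := congr1 (fun p : {poly _} => size p) sE.
  by rewrite size_XnsubC// size_prod_XsubC => -[].
have : root ('X^m - a%:P) z by rewrite sE root_prod_XsubC.
by rewrite /root !hornerE subr_eq0 => /eqP.
Qed.

(** Each [a] has [m] roots of order [m], and raising to the power [m] sends them
    back to [m] copies of [a]. *)
Lemma zeros_prod_XnsubC (m : nat) (l : seq R[i]) : (0 < m)%N ->
  perm_eq (map (fun z => z ^+ m) (zeros (\prod_(a <- l) ('X^m - a%:P))))
    (flatten (map (nseq m) l)).
Proof.
move=> m0.
have [s sE ls] : exists2 s : seq R[i], map (fun z => z ^+ m) s = flatten (map (nseq m) l) &
    \prod_(a <- l) ('X^m - a%:P) = \prod_(z <- s) ('X - z%:P).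
  elim: l => [|a l [s sE ls]]; first by exists [::] => //; rewrite !big_nil.
  have [t [st ta tE]] := XnsubC_splits a m0.
  exists (t ++ s); last by rewrite big_cons big_cat tE ls.
  rewrite map_cat sE /=; congr (_ ++ _).
  rewrite -[X in nseq X]st -(size_map (fun z => z ^+ m)).
  by apply/all_pred1P/allP => _ /mapP[z /ta za ->]; rewrite /= za.
rewrite -sE; apply: perm_map; apply: prod_XsubC_eq.
have := zerosP (\prod_(a <- l) ('X^m - a%:P)).
have -> : lead_coef (\prod_(a <- l) ('X^m - a%:P)) = 1.
  by rewrite ls; apply/monicP; exact: monic_prod_XsubC.
by rewrite scale1r => E; rewrite -E.
Qed.

Lemma sum_zeros_prod_XnsubC (m : nat) (l : seq R[i]) (h : R[i] -> R) : (0 < m)%N ->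
  \sum_(z <- zeros (\prod_(a <- l) ('X^m - a%:P))) h (z ^+ m) =
  m%:R * \sum_(a <- l) h a.
Proof.
move=> m0; rewrite -(big_map (fun z => z ^+ m) xpredT h).
rewrite (perm_big _ (zeros_prod_XnsubC l m0)) /=.
elim: l => [|a l IH]; first by rewrite !big_nil mulr0.
rewrite /= big_cat IH big_cons mulrDr; congr (_ + _).
by rewrite big_nseq iter_addr_0 mulr_natl.
Qed.

(** Sums of Dirac masses are integrated for nonnegative functions first, then for
    the positive and negative parts of [f]. *)
Lemma integral_root_measure (N : nat) (P : {poly R[i]}) (S : R[i]^o -> R[i]^o)
    (f : R[i]^o -> R) : continuous S -> continuous f ->
  (\int[pushforward (root_measure N P) (S : borelC R -> borelC R)]_(x in [set: borelC R])
    (f x)%:E = (N%:R^-1 * \sum_(z <- zeros P) f (S z))%:E)%E.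
Proof.
move=> cS cf; have mS := measurable_borel cS; have mf := measurable_borel_real cf.
have mEf : measurable_fun setT (fun x : borelC R => (f x)%:E).
  exact/measurable_EFinP.
have ge0 (g : borelC R -> R) : measurable_fun setT (EFin \o g) -> (forall x, 0 <= g x) ->
    (\int[pushforward (root_measure N P) (S : borelC R -> borelC R)]_(x in setT)
      (g x)%:E = (N%:R^-1 * \sum_(z <- zeros P) g (S z))%:E)%E.
  move=> mg g0; rewrite ge0_integral_pushforward//; last by move=> y _; rewrite lee_fin.
  rewrite preimage_setT.
  rewrite ge0_integral_mscale//; last 2 first.
  - exact: measurableT_comp mg mS.
  - by move=> x _; rewrite lee_fin.
  rewrite ge0_integral_measure_sum//; last 2 first.
  - by move=> x _; rewrite lee_fin.
  - exact: measurableT_comp mg mS.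
  rewrite EFinM; congr (_ * _)%E.
  rewrite (big_nth 0) big_mkord -sumEFin; apply: eq_bigr => k _.
  rewrite integral_dirac//=; last exact: measurableT_comp mg mS.
  by rewrite diracT mul1e.
have fp x : ((fun x : borelC R => (f x)%:E)^\+ x = (Num.max (f x) 0)%:E)%E.
  by rewrite funeposE EFin_max.
have fn x : ((fun x : borelC R => (f x)%:E)^\- x = (Num.max (- f x) 0)%:E)%E.
  by rewrite funenegE EFin_max.
transitivity (\int[pushforward (root_measure N P) (S : borelC R -> borelC R)]_x
      (fun x : borelC R => (f x)%:E)^\+ x -
    \int[pushforward (root_measure N P) (S : borelC R -> borelC R)]_x
      (fun x : borelC R => (f x)%:E)^\- x)%E.
  exact: integral_pushforwardE mS.
under eq_integral do rewrite fp; under [X in (_ - X)%E]eq_integral do rewrite fn.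
have mp : measurable_fun setT (EFin \o (fun x : borelC R => Num.max (f x) 0)).
  apply: (eq_measurable_fun ((fun x : borelC R => (f x)%:E)^\+%E)) => [x _|].
    exact: fp.
  exact: measurable_funepos.
have mn : measurable_fun setT (EFin \o (fun x : borelC R => Num.max (- f x) 0)).
  apply: (eq_measurable_fun ((fun x : borelC R => (f x)%:E)^\-%E)) => [x _|].
    exact: fn.
  exact: measurable_funeneg.
rewrite (ge0 (fun x => Num.max (f x) 0))//; last by move=> x; rewrite le_max lexx orbT.
rewrite (ge0 (fun x => Num.max (- f x) 0))//; last by move=> x; rewrite le_max lexx orbT.
rewrite -EFinB -mulrBr -sumrB; congr (_ * _)%:E; apply: eq_bigr => z _.
exact: maxr0_subN.
Qed.

End root_measure.

(** * The inverse of the transform *)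

Lemma cvg_of_sqr_dist (R : realType) (y : nat -> R) (l C : R) :
  (\forall n \near \oo, (y n - l) ^+ 2 <= C * n%:R^-1) -> y n @[n --> \oo] --> l.
Proof.
move=> yC; apply/cvgrPdist_le => e e0.
have e2 : 0 < e ^+ 2 by rewrite exprn_gt0.
pose N := (Num.truncn (C / e ^+ 2)).+1.
apply: filterS2 yC (nbhs_infty_gt N) => n yn Nn.
have n0 : (0 < n)%N by exact: leq_ltn_trans Nn.
rewrite distrC -(@ler_pXn2r _ 2)// ?nnegrE// ?(ltW e0)// real_normK ?num_real//.
apply: (le_trans yn); rewrite ler_pdivrMr ?ltr0n// mulrC -ler_pdivrMr//.
apply: ltW; apply: (lt_trans (truncnS_gt _)); by rewrite ltr_nat.
Qed.

Section inverse_transform.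
Variables (R : realType) (j : nat) (b : nat -> R).
Hypothesis b_ge1 : forall s, (1 <= s <= j)%N -> 1 <= b s.

Definition inv_transform (al : R) : R :=
  al / (1 - al) * \prod_(1 <= s < j.+1) (b s - 1 + al).

Lemma prod_inv_transform_gt0 al : 0 < al -> 0 < \prod_(1 <= s < j.+1) (b s - 1 + al).
Proof.
move=> al0; rewrite big_nat prodr_gt0// => s; rewrite ltnS => /b_ge1 b1.
by rewrite ltr_wpDl// subr_ge0.
Qed.

Lemma inv_transform_gt0 al : 0 < al < 1 -> 0 < inv_transform al.
Proof.
move=> /andP[al0 al1]; rewrite mulr_gt0 ?prod_inv_transform_gt0// divr_gt0// subr_gt0//.
Qed.

Lemma inv_transform_surj t : 0 < t -> exists2 al, 0 < al < 1 & inv_transform al = t.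
Proof.
move=> t0.
pose p : {poly R} := 'X * \prod_(1 <= s < j.+1) ('X + (b s - 1)%:P) - t *: (1 - 'X).
have pE x : p.[x] = x * \prod_(1 <= s < j.+1) (b s - 1 + x) - t * (1 - x).
  rewrite /p hornerD hornerN hornerM hornerX horner_prod hornerZ hornerD hornerN.
  rewrite hornerX -polyC1 hornerC; congr (_ * _ - _); apply: eq_bigr => s _.
  by rewrite hornerD hornerX hornerC addrC.
have p1 : 0 < p.[1] by rewrite pE subrr mulr0 subr0 mul1r prod_inv_transform_gt0.
have p0 : p.[0] < 0 by rewrite pE mul0r sub0r subr0 mulr1 oppr_lt0.
have [|al] := @poly_ivt R p 0 1 ler01.
  by rewrite (ltW p0) ltW.
move=> /andP[al0 al1] /eqP pal.
have al0' : 0 < al.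
  by rewrite lt_neqAle al0 andbT; apply: contraTneq p0 => h; rewrite [X in p.[X]]h pal ltxx.
have al1' : al < 1.
  by rewrite lt_neqAle al1 andbT; apply: contraTneq p1 => h; rewrite -[X in p.[X]]h pal ltxx.
exists al; first by rewrite al0' al1'.
have n1 : 1 - al != 0 by rewrite subr_eq0 gt_eqF.
apply: (mulIf n1); rewrite /inv_transform mulrAC divfK//.
by apply/eqP; rewrite -subr_eq0 -pE pal.
Qed.

End inverse_transform.

(** With [t] for [inv_transform j b al], this is the concentration estimate at
    [x = t^-1]: its hypothesis on [al] is the definition of [t]. *)
Lemma cvg_resolvent (R : realType) (j : nat) (b : nat -> R) (sigma : {perm 'I_j})
    (r : nat -> seq R) :
  (forall s, (1 <= s <= j)%N -> 1 <= b s) ->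
  (forall n, size (r n) = n) -> (forall n, {in r n, forall x, 0 <= x}) ->
  (forall n, (0 < n)%N -> exists a : 'I_j -> R,
    (forall s, (b (sigma s).+1 - 1) - n%:R^-1 <= a s <= b (sigma s).+1 - 1) /\
    forall k, (rpoly (r n))`_k =
      'C(n, k)%:R * \prod_(s < j) \prod_(i < k) (1 + a s - n%:R^-1 * i%:R)) ->
  forall al, 0 < al < 1 ->
  avg (r n) (fun x => inv_transform j b al * (inv_transform j b al + x)^-1)
    @[n --> \oo] --> al.
Proof.
move=> b1 r_size r_ge0 rE al al01; have t0 := inv_transform_gt0 b1 al01.
set t := inv_transform j b al in t0 *; have /andP[al0 al1] := al01.
pose be s := b (sigma s).+1 - 1.
have be0 s : 0 <= be s by rewrite subr_ge0 b1//= ltn_ord.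
have alE : 1 - al = t^-1 * (al * \prod_(s < j) (al + be s)).
  have -> : \prod_(s < j) (al + be s) = \prod_(1 <= s < j.+1) (b s - 1 + al).
    rewrite big_add1 /= big_mkord [RHS](reindex_inj (@perm_inj _ sigma)) /=.
    by apply: eq_bigr => s _; rewrite addrC.
  have P0 := lt0r_neq0 (prod_inv_transform_gt0 b1 al0).
  have n1 : 1 - al != 0 by rewrite subr_eq0 gt_eqF.
  have nal := lt0r_neq0 al0.
  by rewrite /t /inv_transform; field; rewrite P0 n1 nal.
apply: (@cvg_of_sqr_dist _ _ _ (t^-1 * (j.+1%:R * \prod_(s < j) (1 + be s)))).
apply: filterS (nbhs_infty_gt 0) => n n0; have [a [a_be aE]] := rE _ n0.
have al01' : 0 <= al <= 1 by rewrite !ltW.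
have t0' : 0 <= t^-1 by rewrite invr_ge0 ltW.
have := mean_resolvent_approx n0 be0 a_be t0' al01' alE (r_size n) (@r_ge0 n) aE.
rewrite /avg r_size; congr ((_ * _ - _) ^+ 2 <= _); apply: eq_big_seq => x /r_ge0 x0.
have tx : t + x != 0 by rewrite lt0r_neq0// ltr_wpDr.
by field; rewrite tx lt0r_neq0.
Qed.

(** * Convergence of the root measures *)

Section transfer.
Context {R : realType}.
Local Notation U01 := (uniform_prob (@ltr01 R)).

Lemma measurable_inv : measurable_fun [set: measurableTypeR R]
  (GRing.inv : measurableTypeR R -> measurableTypeR R).
Proof.
(* The convention [0^-1 = 0] makes this identity hold at [0] as well. *)
rewrite (_ : GRing.inv = (fun x : R => x * (x ^+ 2) `^ (-1))); last first.
  apply/funext => x; rewrite powR_inv1 ?sqr_ge0// expr2.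
  have [->|x0] := eqVneq x 0; first by rewrite invr0 mul0r.
  by field.
apply: measurable_funM; first exact: measurable_id.
by apply: (measurableT_comp (measurable_powR _)); exact: measurable_funX.
Qed.

Lemma integral_law (Z : {mfun measurableTypeR R >-> measurableTypeR R}) (f : R -> R) (M : R) :
  measurable_fun [set: measurableTypeR R] (f : measurableTypeR R -> measurableTypeR R) ->
  (forall u, `|f (Z u)| <= M) ->
  (\int[distribution U01 Z]_x (f x)%:E = (\int[U01]_u f (Z u))%:E)%E.
Proof.
move=> mf fM.
have iF : U01.-integrable setT (EFin \o (fun u => f (Z u))).
  apply: (bounded_integrable U01 (M := M)) => //.
  exact: measurableT_comp mf _.
rewrite integral_pushforward//.
- by rewrite /Rintegral fineK//; exact: integrable_fin_num.
- exact/measurable_EFinP.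
Qed.

End transfer.

Theorem theorem5p14 (R : realType) (c : R) (m j : nat) (b : nat -> R)
    (sigma : {perm 'I_j}) :
  0 < c -> (0 < m)%N -> (m <= j.+1)%N ->
  b 0%N = 1 -> (forall s, (1 <= s <= j)%N -> 1 <= b s) ->
  let S : borelC R -> borelC R := fun x : R[i] => - x ^+ m / c%:C in
  exists mu : probability (measurableTypeR R) R,
    [/\ mu `]-oo, 0]%classic = 1%E,
        inverse_between `]0, +oo[%classic `]0, 1[%classic
          (fun t => t * cauchy_transform mu t)
          (fun alpha => alpha / (1 - alpha) *
             \prod_(1 <= s < j.+1) (b s - 1 + alpha)) &
        weak_cvg
          (fun n => pushforward
             (root_measure (n * m)
                (map_poly (real_complex R) (expH n m b c sigma))) S)
          (pushforward mu (real_complex R : measurableTypeR R -> borelC R))].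
Proof.
move=> c0 m0 mj b0 b1 S; have mjj : (0 < m <= j.+1)%N by rewrite m0.
have /choice[r rP] : forall n, exists rs : seq R,
    [/\ size rs = n, {in rs, forall x, 0 <= x} & (0 < n)%N ->
      exists a : 'I_j -> R, [/\
        forall s, (b (sigma s).+1 - 1) - n%:R^-1 <= a s <= b (sigma s).+1 - 1,
        forall k, (rpoly rs)`_k =
          'C(n, k)%:R * \prod_(s < j) \prod_(i < k) (1 + a s - n%:R^-1 * i%:R) &
        expH n m b c sigma = \prod_(x <- rs) ('X^m - (c * x)%:P)]].
  case=> [|n]; first by exists [::].
  have [a [rs [a_b srs rs0 rsE HE]]] := expH_factor sigma c (ltn0Sn n) mjj b0 b1.
  by exists rs; split=> // _; exists a.
have r_size n : size (r n) = n by have [] := rP n.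
have r_ge0 n : {in r n, forall x, 0 <= x} by have [] := rP n.
have res al : 0 < al < 1 ->
    avg (r n) (fun x => inv_transform j b al * (inv_transform j b al + x)^-1)
      @[n --> \oo] --> al.
  apply: (cvg_resolvent (sigma := sigma)) => // n n0.
  by have [_ _ /(_ n0)[a [a_b aE _]]] := rP n; exists a.
have resV al : 0 < al < 1 ->
    avg (r n) (fun x => (inv_transform j b al + x)^-1) @[n --> \oo] -->
      (inv_transform j b al)^-1 * al.
  move=> al01; have t0 := lt0r_neq0 (inv_transform_gt0 b1 al01).
  rewrite (_ : (fun n => _) = (fun n => (inv_transform j b al)^-1 *
      avg (r n) (fun x => inv_transform j b al * (inv_transform j b al + x)^-1))).
    by apply: cvgMr; exact: res.
  by apply/funext => n; rewrite avgZ mulKf.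
have [||Z [mZ Z0 Zcvg]] := weak_limit_of_resolvents r_size r_ge0.
- move=> t t0; have [al al01 <-] := inv_transform_surj b1 t0.
  by apply/cvg_ex; exists ((inv_transform j b al)^-1 * al); exact: resV.
- (* Tightness, from a value of the transform close to [1]. *)
  move=> e e0; pose al := Num.max 2^-1 (1 - e / 2).
  have e2 : 0 < e / 2 by rewrite divr_gt0.
  have al01 : 0 < al < 1.
    by rewrite lt_max gt_max invr_gt0 ltr0n /= invf_lt1 ?ltr1n//= ltrBlDr ltrDl e2.
  exists (inv_transform j b al); first exact: inv_transform_gt0.
  have /cvgrPdist_le/(_ _ e2) := res _ al01; apply: filterS => n.
  have : 1 - e / 2 <= al by rewrite le_max lexx orbT.
  rewrite ler_norml => h /andP[_ h2]; lra.
have mZ' : measurable_fun [set: measurableTypeR R]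
  (Z : measurableTypeR R -> measurableTypeR R) := mZ.
pose X : {mfun measurableTypeR R >-> measurableTypeR R} :=
  @mfun_Sub _ _ (measurableTypeR R) (measurableTypeR R) Z (mem_set mZ').
pose mu : probability (measurableTypeR R) R := distribution (uniform_prob (@ltr01 R)) X.
have cauchy al : 0 < al < 1 ->
    inv_transform j b al * cauchy_transform mu (inv_transform j b al) = al.
  move=> al01; have t0 := inv_transform_gt0 b1 al01; set t := inv_transform j b al in t0 *.
  have tZ u : `|(t - Z u)^-1| <= t^-1.
    have tzu : t <= t - Z u by rewrite lerDl oppr_ge0.
    have tz0 : 0 < t - Z u by exact: lt_le_trans tzu.
    by rewrite ger0_norm ?invr_ge0 ?(ltW tz0)// lef_pV2.
  rewrite /cauchy_transform /Rintegral (integral_law (M := t^-1))//; last first.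
    apply: (measurableT_comp measurable_inv).
    by apply: measurable_funB; [exact: measurable_cst|exact: measurable_id].
  (* The law of [Z] only sees [z <= 0], where [g] is the Cauchy kernel; the
     minimum makes it continuous and bounded on the whole line. *)
  pose g (z : R) := (t - Num.min 0 z)^-1.
  have tmin z : 0 < t - Num.min 0 z.
    by rewrite ltr_pwDl// oppr_ge0 ge_min lexx.
  have cg : continuous g.
    move=> z; apply: (@continuousV R R (fun w => t - Num.min 0 w)); first by rewrite lt0r_neq0.
    apply: continuousB; first exact: cst_continuous.
    by apply: (@continuous_min R R (fun=> 0) id); [exact: cst_continuous|exact: cvg_id].
  have gM z : `|g z| <= t^-1.
    rewrite ger0_norm ?invr_ge0 ?(ltW (tmin z))// lef_pV2 ?posrE//.
    by rewrite lerDl oppr_ge0 ge_min lexx.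
  have cZ := Zcvg _ _ cg gM.
  rewrite (_ : (fun n => avg (r n) (fun x => g (- x))) =
      (fun n => avg (r n) (fun x => (t + x)^-1))) in cZ; last first.
    apply/funext => n; apply: eq_avg => x /r_ge0 x0.
    by rewrite /g (min_idPr _) ?oppr_le0// opprK.
  have E : \int[uniform_prob (@ltr01 R)]_u g (Z u) = t^-1 * al.
    exact: cvg_unique cZ (resV _ al01).
  transitivity (t * \int[uniform_prob (@ltr01 R)]_u g (Z u)).
    congr (t * _); apply: eq_Rintegral => u _.
    by rewrite /g (min_idPr (Z0 u)).
  by rewrite E mulVKf// lt0r_neq0.
exists mu; split.
- rewrite /mu /distribution /pushforward /= (_ : _ @^-1` _ = setT) ?probability_setT//.
  by apply/seteqP; split => // u _; exact: Z0.
- rewrite !set_itvE; split=> [t t0|al /(inv_transform_gt0 b1)//|t|al].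
  + have [al al01 <-] := inv_transform_surj b1 t0; by rewrite /= cauchy.
  + rewrite inE /= => t0; have [al al01 <-] := inv_transform_surj b1 t0.
    by rewrite cauchy.
  + by rewrite inE /= => al01; rewrite -/(inv_transform j b al) cauchy.
- move=> f cf [M fM].
  have cfr : continuous (fun x : R => f x%:C).
    move=> x; apply: (@continuous_comp R (R[i]^o) R (real_complex R) f x).
      exact: continuous_real_complex.
    exact: cf.
  have cS : continuous (S : R[i]^o -> R[i]^o).
    exact: continuous_N_exprn_div.
  have mf := measurable_borel_real cf.
  have -> : (\int[pushforward mu (real_complex R : measurableTypeR R -> borelC R)]_x
      (f x)%:E)%E = (\int[uniform_prob (@ltr01 R)]_u f (Z u)%:C)%:E.
    have mfr : measurable_fun [set: measurableTypeR R]
      ((fun x => f x%:C) : measurableTypeR R -> measurableTypeR R).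
      exact: measurableT_comp mf measurable_real_complex.
    rewrite integral_pushforward//; last 3 first.
    - exact: measurable_real_complex.
    - exact/measurable_EFinP.
    - by rewrite preimage_setT; apply: (bounded_integrable mu (M := M) mfr).
    rewrite preimage_setT.
    exact: (integral_law (Z := X) (M := M) mfr).
  have cfR := Zcvg _ _ cfr (fun x => fM x%:C).
  have cfE : (avg (r n) (fun x => f (- x)%:C))%:E @[n --> \oo] -->
      (\int[uniform_prob (@ltr01 R)]_u f (Z u)%:C)%:E.
    by apply/fine_cvgP; split; [exact: nearW|exact: cfR].
  apply: cvg_trans cfE; apply: near_eq_cvg.
  apply: filterS (nbhs_infty_gt 0) => n n0.
  have [_ _ /(_ n0)[a [_ _ HE]]] := rP n.
  have PE : map_poly (real_complex R) (expH n m b c sigma) =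
      \prod_(a <- map (fun x => (c * x)%:C) (r n)) ('X^m - a%:P).
    rewrite HE big_map rmorph_prod; apply: eq_bigr => x _ /=.
    by rewrite rmorphB /= map_polyXn map_polyC.
  rewrite integral_root_measure// PE; congr (_%:E).
  have -> := sum_zeros_prod_XnsubC (map (fun x => (c * x)%:C) (r n))
    (fun a => f (- a / c%:C)) m0.
  rewrite big_map /avg r_size natrM invfM -mulrA mulKf ?pnatr_eq0 -?lt0n//.
  congr (_ * _); apply: eq_bigr => x _; congr f.
  rewrite rmorphM rmorphN /= mulNr mulrAC divff ?mul1r//.
  by rewrite (fmorph_eq0 (real_complex R)) gt_eqF.
Qed.
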